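(* Let $k$ be a positive integer with $k\equiv 62\pmod{125}$. Then for all integers $n\geq 0$, $$\Delta_{k}(125n+99)\equiv 0\pmod{25}.$$
   Context: For a positive integer $k$, $\Delta_k(n)$ denotes the number of broken $k$-diamond partitions of $n$ (Andrews and Paule). The integers $\Delta_k(n)$, $n\ge 0$, are determined by the generating function $$\sum_{n=0}^{\infty}\Delta_{k}(n)q^{n}=\frac{(q^{2};q^{2})_{\infty}\,(q^{2k+1};q^{2k+1})_{\infty}}{(q;q)_{\infty}^{3}\,(q^{2(2k+1)};q^{2(2k+1)})_{\infty}},$$ where $|q|<1$ (or as formal power series in $q$) and $(a;q)_{\infty}:=\prod_{n=0}^{\infty}(1-aq^{n})$. This identity may be taken as the definition of $\Delta_k(n)$. *)

(* Defs.v *)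
From mathcomp Require Import all_boot all_order all_algebra.

Set Implicit Arguments.
Unset Strict Implicit.
Unset Printing Implicit Defensive.

Import Order.TTheory GRing.Theory Num.Theory.

Local Open Scope ring_scope.

(* Formal power series over int, given by their coefficient sequences. *)
Definition fps := nat -> int.

Definition fps_one : fps := fun n => (n == 0%N)%:R.

Definition fps_mul (f g : fps) : fps :=
  fun n => \sum_(i < n.+1) f i * g (n - i)%N.

Definition fps_exp (f : fps) (m : nat) : fps := iter m (fps_mul f) fps_one.

(* First n coefficients of 1/f, for f with constant coefficient 1: the
   recurrence is [q^m] (f * (1/f)) = (m == 0) solved for the m-th coefficient
   of 1/f. *)
Fixpoint fps_inv_seq (f : fps) (n : nat) : seq int :=
  if n is m.+1 then
    let s := fps_inv_seq f m in
    rcons s (fps_one m - \sum_(i < m) s`_i * f (m - i)%N)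
  else [::].

Definition fps_inv (f : fps) : fps := fun n => (fps_inv_seq f n.+1)`_n.

Definition fps_div (f g : fps) : fps := fps_mul f (fps_inv g).

Definition qpoch_trunc (a b N : nat) : {poly int} :=
  \prod_(0 <= j < N) (1 - 'X^(a + b * j)).

(* The series (q^a; q^b)_oo, for a, b > 0.  The factors with j > n do not
   contribute to the coefficient of q^n (see qpoch_stable), so this is the
   coefficientwise limit of the finite products. *)
Definition qpoch (a b : nat) : fps := fun n => (qpoch_trunc a b n.+1)`_n.

(* Number of broken k-diamond partitions of n, through its generating
   function. *)
Definition Delta (k : nat) : fps :=
  fps_div
    (fps_mul (qpoch 2 2) (qpoch (2 * k + 1) (2 * k + 1)))
    (fps_mul (fps_exp (qpoch 1 1) 3)
             (qpoch (2 * (2 * k + 1)) (2 * (2 * k + 1)))).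

Lemma qpoch_stable (a b n N : nat) :
  (0 < a)%N -> (0 < b)%N -> (n < N)%N ->
  (qpoch_trunc a b N)`_n = qpoch a b n.
Proof.
move=> a0 b0; elim: N => // N IH; rewrite ltnS leq_eqVlt => /orP[/eqP->//|nN].
rewrite /qpoch_trunc big_nat_recr //= mulrBr mulr1 coefB coefMXn IH //.
have lt_n : (n < a + b * N)%N.
  apply: (leq_trans nN); apply: leq_trans (leq_addl _ _).
  by rewrite leq_pmull.
by rewrite lt_n subr0.
Qed.

Lemma qpoch0 (a b : nat) : (0 < a)%N -> qpoch a b 0 = 1.
Proof.
case: a => // a _.
by rewrite /qpoch /qpoch_trunc big_nat1 muln0 addn0 coefB coef1 coefXn subr0.
Qed.

Lemma size_fps_inv_seq (f : fps) (n : nat) : size (fps_inv_seq f n) = n.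
Proof. by elim: n => //= n IH; rewrite size_rcons IH. Qed.

Lemma nth_fps_inv_seq (f : fps) (n i : nat) :
  (i < n)%N -> (fps_inv_seq f n)`_i = fps_inv f i.
Proof.
elim: n => // n IH; rewrite ltnS leq_eqVlt => /orP[/eqP->//|lt_in].
by rewrite /= nth_rcons size_fps_inv_seq lt_in IH.
Qed.

Lemma fps_mulVf (f : fps) : f 0%N = 1 -> fps_mul (fps_inv f) f =1 fps_one.
Proof.
move=> f0 n; rewrite /fps_mul big_ord_recr /= subnn f0 mulr1.
rewrite {2}/fps_inv /= nth_rcons size_fps_inv_seq ltnn eqxx.
under [X in fps_one n - X]eq_bigr => i _ do rewrite nth_fps_inv_seq //.
by rewrite addrC subrK.
Qed.

Lemma fps_mulC (f g : fps) : fps_mul f g =1 fps_mul g f.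
Proof.
move=> n; rewrite /fps_mul (reindex_inj rev_ord_inj) /=.
by apply: eq_bigr => i _; rewrite subSS subKn 1?mulrC // -ltnS.
Qed.

Lemma fps_mulA (f g h : fps) :
  fps_mul f (fps_mul g h) =1 fps_mul (fps_mul f g) h.
Proof.
move=> n; pose P (u : fps) : {poly int} := \poly_(i < n.+1) u i.
have PM u v m : (m <= n)%N -> (P u * P v)`_m = fps_mul u v m.
  move=> le_mn; rewrite coefM; apply: eq_bigr => i _.
  rewrite !coef_poly !ltnS (leq_trans (leq_subr _ _) le_mn).
  by rewrite (leq_trans _ le_mn) // -ltnS.
have E1 : (P f * (P g * P h))`_n = fps_mul f (fps_mul g h) n.
  rewrite coefM; apply: eq_bigr => i _.
  by rewrite PM ?leq_subr // coef_poly ltn_ord.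
rewrite -E1 mulrA coefM; apply: eq_bigr => i _.
by rewrite PM -1?ltnS // coef_poly ltnS leq_subr.
Qed.

Lemma eq_fps_mul (f f' g g' : fps) :
  f =1 f' -> g =1 g' -> fps_mul f g =1 fps_mul f' g'.
Proof. by move=> ef eg n; apply: eq_bigr => i _; rewrite ef eg. Qed.

Lemma fps_mulf1 (f : fps) : fps_mul f fps_one =1 f.
Proof.
move=> n; rewrite /fps_mul big_ord_recr /= subnn mulr1 big1 ?add0r // => i _.
by rewrite /fps_one subn_eq0 leqNgt ltn_ord mulr0.
Qed.

Lemma fps_mul0 (f g : fps) : fps_mul f g 0%N = f 0%N * g 0%N.
Proof. by rewrite /fps_mul zmodp.big_ord1. Qed.

(* The generating function identity, with denominators cleared. *)
Lemma Delta_genfun (k : nat) :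
  fps_mul (Delta k)
    (fps_mul (fps_exp (qpoch 1 1) 3)
             (qpoch (2 * (2 * k + 1)) (2 * (2 * k + 1))))
  =1 fps_mul (qpoch 2 2) (qpoch (2 * k + 1) (2 * k + 1)).
Proof.
move=> n; rewrite /Delta /fps_div -fps_mulA.
set A := fps_mul (qpoch 2 2) _; set B := fps_mul _ (qpoch _ _).
rewrite -[RHS]fps_mulf1; apply: eq_fps_mul => // m; apply: fps_mulVf.
rewrite /B /fps_exp /= !fps_mul0 !qpoch0 ?mulr1 //.
by rewrite muln_gt0 addn1.
Qed.

(* Main.v *)
Require Import Defs.
From HB Require Import structures.
From mathcomp Require Import all_boot all_order all_algebra.
From mathcomp Require Import boolp.
From mathcomp Require Import ring zify.
From mathcomp Require Import all_field.

(** Write E for (q; q)_oo, E_d for its image under q -> q^d, and psi for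
    E_2^2 / E, which by Gauss is the sum of q^(n(n+1)/2).  If 2k+1 = 125m, the
    generating function of the broken k-diamond partitions is
    F = E_2 / E^3 = psi^3 / E_2^5 times a series in q^125.  Since
    125n+99 = 5(5(5n+3)+4)+4, it suffices that three successive sections of F,
    along the residues 4, 4 and 3 modulo 5, leave a multiple of 25.

    A section commutes with multiplication by a series in q^5, so the work is
    to write psi and E_2 over the series in q^5.  The pentagonal number
    theorem and Gauss's identity, obtained as limits of two finite identities
    of Shanks ([shanks_pentagonal], [shanks_triangular]), show that E has only
    the residues 0, 1, 2 and psi only the residues 0, 1, 3, and that residue 1
    of E and residue 3 of psi are -q E_25 and q^3 psi(q^25).  Comparing
    residues in E psi = E_2^2 determines the remaining pieces up to two
    parameters z and k ([level10_parameters]): with theta = P0 + q P1 + q^3,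
    where P0 and P1 are taken at q^5, one has psi = psi(q^25) theta, and P0,
    P1, a component y of E_2, and q itself are polynomials in z and k.  Here k
    is the classical parameter R(q) R(q^2)^2, R being the Rogers-Ramanujan
    continued fraction; every further relation between theta functions becomes
    a polynomial identity in z and k.

    One relation is still needed, between psi and the pieces P0, P1 that
    belong to the fifth root of q.  It comes from multiplying psi over the five
    substitutions q -> w q with w^5 = 1: the product formula gives
    psi(q)^6 / psi(q^5) at q^5, and the expansion in P0 and P1 gives a cubic, so
    that psi^2 = psi(q^5)^2 (P0 P1 + q) ([psi_square]).

    Modulo 25 negative powers disappear: if T is a fifth power such as theta^5,
    then T = N + 5h with N a series in q^5, and T (2N - T) = N^2 - 25h^2.  So
    multiplication by 2N - T replaces T by a series in q^5.  With
    V = P0 P1 + q the first section of F becomes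
    psi(q^5)^3 (16 V^2 + 24 q V + 10 q^2) / (E_10^5 V^3) ([first_sect]).
    Modulo 5 the coefficients 16, 24, 10 are 1, -1, 0, and this is what makes
    the second section divisible by 5 ([second_sect]).  The third section is
    then only needed modulo 5, where f^5 = f(q^5) turns it into
    2 (psi^2 psi(q^5) - psi^7) / E_2, which is 0 ([third_sect]). *)

Set Implicit Arguments.
Unset Strict Implicit.
Unset Printing Implicit Defensive.

Import Order.TTheory GRing.Theory Num.Theory.

Local Open Scope ring_scope.

(** * Formal power series *)

Record pseries (R : Type) := PSeries { pscoef :> nat -> R }.

HB.instance Definition _ (R : Type) := gen_eqMixin (pseries R).
HB.instance Definition _ (R : Type) := gen_choiceMixin (pseries R).

Lemma pseriesP (R : Type) (f g : pseries R) : f =1 g <-> f = g.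
Proof.
split=> [|->//]; case: f g => f [g] /= fg.
by congr PSeries; apply: funext.
Qed.

Section PowerSeriesRing.
Variable R : comNzRingType.
Implicit Types f g h : pseries R.

Definition ps_zero : pseries R := PSeries (fun=> 0).
Definition ps_opp f := PSeries (fun n => - f n).
Definition ps_add f g := PSeries (fun n => f n + g n).
Definition ps_one : pseries R := PSeries (fun n => (n == 0%N)%:R).
Definition ps_mul f g := PSeries (fun n => \sum_(i < n.+1) f i * g (n - i)%N).

Fact ps_addA : associative ps_add.
Proof. by move=> f g h; apply/pseriesP => n /=; rewrite addrA. Qed.
Fact ps_addC : commutative ps_add.
Proof. by move=> f g; apply/pseriesP => n /=; rewrite addrC. Qed.
Fact ps_add0 : left_id ps_zero ps_add.
Proof. by move=> f; apply/pseriesP => n /=; rewrite add0r. Qed.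
Fact ps_addN : left_inverse ps_zero ps_opp ps_add.
Proof. by move=> f; apply/pseriesP => n /=; rewrite addNr. Qed.

HB.instance Definition _ :=
  GRing.isZmodule.Build (pseries R) ps_addA ps_addC ps_add0 ps_addN.

(** The coefficient of q^n in a product depends only on polynomial truncations,
    so the ring axioms for series follow from those for polynomials. *)
Definition ps_trunc N f : {poly R} := \poly_(i < N) f i.

Lemma coef_ps_truncM N f g n : (n < N)%N ->
  (ps_trunc N f * ps_trunc N g)`_n = ps_mul f g n.
Proof.
move=> ltnN; rewrite coefM; apply: eq_bigr => i _.
have leiN : (i < N)%N by apply: leq_ltn_trans ltnN; rewrite -ltnS.
by rewrite !coef_poly leiN (leq_ltn_trans (leq_subr _ _) ltnN).
Qed.

Fact ps_mulC : commutative ps_mul.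
Proof.
move=> f g; apply/pseriesP => n.
by rewrite -!(@coef_ps_truncM n.+1) // mulrC.
Qed.
Fact ps_mulA : associative ps_mul.
Proof.
move=> f g h; apply/pseriesP => n.
transitivity (ps_trunc n.+1 f * (ps_trunc n.+1 g * ps_trunc n.+1 h))`_n.
  rewrite coefM; apply: eq_bigr => i _.
  by rewrite coef_ps_truncM ?ltnS ?leq_subr // coef_poly ltn_ord.
rewrite mulrA coefM; apply: eq_bigr => i _.
by rewrite coef_ps_truncM ?ltnS -1?ltnS // coef_poly ltnS leq_subr.
Qed.
Fact ps_mul1 : left_id ps_one ps_mul.
Proof.
move=> f; apply/pseriesP => n /=.
by rewrite big_ord_recl /= subn0 mul1r big1 ?addr0 // => i _; rewrite mul0r.
Qed.
Fact ps_mulDl : left_distributive ps_mul +%R.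
Proof.
move=> f g h; apply/pseriesP => n /=.
by rewrite -big_split; apply: eq_bigr => i _; rewrite mulrDl.
Qed.
Fact ps_one_neq0 : ps_one != 0.
Proof.
apply/eqP => /pseriesP/(_ 0%N) /= /eqP.
by rewrite oner_eq0.
Qed.

HB.instance Definition _ := GRing.Zmodule_isComNzRing.Build (pseries R)
  ps_mulA ps_mulC ps_mul1 ps_mulDl ps_one_neq0.

Lemma coefps0 n : (0 : pseries R) n = 0. Proof. by []. Qed.
Lemma coefps1 n : (1 : pseries R) n = (n == 0%N)%:R. Proof. by []. Qed.
Lemma coefpsD f g n : (f + g) n = f n + g n. Proof. by []. Qed.
Lemma coefpsN f n : (- f) n = - f n. Proof. by []. Qed.
Lemma coefpsB f g n : (f - g) n = f n - g n. Proof. by []. Qed.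
Lemma coefpsM f g n : (f * g) n = \sum_(i < n.+1) f i * g (n - i)%N.
Proof. by []. Qed.
Lemma coefps_natl m f n : (m%:R * f) n = m%:R * f n.
Proof.
by rewrite !mulr_natl; elim: m => // m IH; rewrite !mulrS coefpsD IH.
Qed.
Lemma coefps_sum I (r : seq I) (P : pred I) (F : I -> pseries R) n :
  (\sum_(i <- r | P i) F i) n = \sum_(i <- r | P i) F i n.
Proof. exact: (big_morph (fun f : pseries R => f n)). Qed.

Lemma coefpsM0 f g : (f * g) 0%N = f 0%N * g 0%N.
Proof. by rewrite coefpsM big_ord1. Qed.

Lemma coefpsX0 f m : (f ^+ m) 0%N = f 0%N ^+ m.
Proof. by elim: m => // m IH; rewrite !exprS coefpsM0 IH. Qed.

Definition psq : pseries R := PSeries (fun n => (n == 1%N)%:R).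

Lemma coef_psqM f n : (psq * f) n = if n is m.+1 then f m else 0.
Proof.
rewrite coefpsM; case: n => [|n]; first by rewrite big_ord1 mul0r.
rewrite !big_ord_recl /= mul0r add0r mul1r subn1 /= big1 ?addr0 // => i _.
by rewrite mul0r.
Qed.

Lemma coef_psqXnM f m n :
  (psq ^+ m * f) n = if (n < m)%N then 0 else f (n - m)%N.
Proof.
elim: m n => [|m IH] n; first by rewrite mul1r subn0.
by rewrite exprS -mulrA coef_psqM; case: n => // n; rewrite IH.
Qed.

Lemma coef_psqXn m n : (psq ^+ m) n = (n == m)%:R.
Proof.
rewrite -[psq ^+ m]mulr1 coef_psqXnM coefps1 subn_eq0.
by case: ltngtP.
Qed.

(** * Dilation and sections *)

Lemma sum_mult (V : nmodType) (d m r : nat) (F : nat -> V) : (r < d)%N ->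
  (forall i, ~~ (d %| i)%N -> F i = 0) ->
  \sum_(i < (d * m + r).+1) F i = \sum_(j < m.+1) F (d * j)%N.
Proof.
move=> ltrd F0; rewrite -(big_mkord xpredT F) -(big_mkord xpredT (fun j => F (d * j)%N)).
elim: m r ltrd => [|m IH] r ltrd.
  rewrite muln0 add0n big_nat1 muln0 big_nat_recl //= big_nat big1 ?addr0 // => i.
  move=> /andP[_ ltir]; apply: F0; rewrite gtnNdvd //.
  exact: leq_ltn_trans ltrd.
have d_gt0 : (0 < d)%N by apply: leq_ltn_trans ltrd.
rewrite [RHS]big_nat_recr //= -(IH d.-1) ?prednK //.
have -> : ((d * m + d.-1).+1 = d * m.+1)%N by rewrite -addnS prednK // mulnS addnC.
rewrite (@big_cat_nat _ _ _ (d * m.+1)%N) /=; last 2 first.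
- by [].
- by rewrite -addnS leq_addr.
congr (_ + _); rewrite big_ltn -?addnS ?addnS ?ltnS ?leq_addr //.
rewrite big_nat big1 ?addr0 // => i /andP[lti iltr]; apply: F0.
apply/negP => /dvdnP[c def_i]; move: lti iltr; rewrite {}def_i mulnC.
rewrite ltn_pmul2r // ltnS => ltmc lecr.
have := leq_trans (leq_mul ltmc (leqnn d)) lecr.
by rewrite mulSn mulnC addnC leq_add2l leqNgt ltrd.
Qed.

(** The substitution q -> q^d. *)
Definition dil (d : nat) f :=
  PSeries (fun n => if (d %| n)%N then f (n %/ d)%N else 0).

Lemma coef_dil d f n :
  dil d f n = if (d %| n)%N then f (n %/ d)%N else 0.
Proof. by []. Qed.

Definition sect (d r : nat) f := PSeries (fun n => f (d * n + r)%N).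

Lemma dil_coef0 d f : dil d f 0%N = f 0%N.
Proof. by rewrite /= dvdn0 div0n. Qed.

(** Sections are linear over the series in q^d; every extraction of an
    arithmetic progression below goes through this. *)
Lemma sect_dilM d r f g : (r < d)%N -> sect d r (dil d f * g) = f * sect d r g.
Proof.
move=> ltrd; apply/pseriesP => n; rewrite /= /GRing.mul /=.
have d_gt0 : (0 < d)%N by apply: leq_ltn_trans ltrd.
rewrite (@sum_mult _ _ _ _
  (fun i => (if (d %| i)%N then f (i %/ d)%N else 0) * g (d * n + r - i)%N)) //.
  apply: eq_bigr => i _; rewrite dvdn_mulr // mulKn //; congr (_ * g _).
  have := ltn_ord i; nia.
by move=> i /negPf ->; rewrite mul0r.
Qed.

Lemma sect_psqM d r f : sect d r.+1 (psq * f) = sect d r f.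
Proof. by apply/pseriesP => n; rewrite [LHS]coef_psqM addnS. Qed.

Lemma sect_is_zmod_morphism d r : zmod_morphism (sect d r).
Proof. by move=> f g; apply/pseriesP. Qed.
HB.instance Definition _ d r := GRing.isZmodMorphism.Build
  (pseries R) (pseries R) (sect d r) (sect_is_zmod_morphism d r).

Lemma sectD d r f g : sect d r (f + g) = sect d r f + sect d r g.
Proof. exact: raddfD. Qed.
Lemma sectB d r f g : sect d r (f - g) = sect d r f - sect d r g.
Proof. exact: raddfB. Qed.

Lemma sect_natl d r m f : sect d r (m%:R * f) = m%:R * sect d r f.
Proof. by rewrite !mulr_natl raddfMn. Qed.

Lemma sect_dil d f : (0 < d)%N -> sect d 0 (dil d f) = f.
Proof. by move=> d_gt0; apply/pseriesP => n; rewrite /= addn0 dvdn_mulr // mulKn. Qed.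

Lemma dil_inj d : (0 < d)%N -> injective (dil d).
Proof. by move=> d_gt0; apply: (can_inj (fun f => sect_dil f d_gt0)). Qed.

End PowerSeriesRing.
Arguments psq {R}.

Local Notation "f `_[ r ]" := (sect 5 r f) (at level 3, format "f `_[ r ]").

Section Dilation.
Variable R : comNzRingType.
Implicit Types f g h : pseries R.

Lemma sectP d f g : (0 < d)%N ->
  (forall r, (r < d)%N -> sect d r f = sect d r g) -> f = g.
Proof.
move=> d_gt0 fg; apply/pseriesP => n.
have /pseriesP/(_ (n %/ d)%N) := fg _ (ltn_pmod n d_gt0).
by rewrite /= mulnC -divn_eq.
Qed.

Lemma sect_dil_neq0 d r f : (0 < r < d)%N -> sect d r (dil d f) = 0.
Proof.
case/andP=> r_gt0 ltrd; apply/pseriesP => n /=.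
by rewrite dvdn_addr ?dvdn_mulr // gtnNdvd.
Qed.

Lemma dil_is_zmod_morphism d : zmod_morphism (@dil R d).
Proof.
move=> f g; apply/pseriesP => n /=.
by case: ifP => // _; rewrite subr0.
Qed.
HB.instance Definition _ d := GRing.isZmodMorphism.Build
  (pseries R) (pseries R) (@dil R d) (@dil_is_zmod_morphism d).

Lemma dil_is_monoid_morphism d : monoid_morphism (@dil R d).
Proof.
split=> [|f g].
  apply/pseriesP => n /=.
  case: n => [|n]; first by rewrite dvdn0 div0n.
  case: ifP => // /dvdnP[c def_n]; rewrite def_n.
  by case: d c def_n => [|d] [|c]; rewrite ?muln0 ?mul0n // mulnK.
case: d => [|d].
  apply/pseriesP => n; rewrite coefpsM coef_dil dvd0n divn0.
  case: n => [|n]; first by rewrite big_ord1 !coef_dil coefpsM0 !div0n.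
  rewrite big1 // => i _; rewrite !coef_dil !dvd0n subn_eq0.
  case: eqP => [->|_]; last by rewrite mul0r.
  by rewrite mulr0.
apply: (@sectP d.+1) => // r ltrd; rewrite sect_dilM //.
case: (posnP r) => [->|r_gt0]; first by rewrite !sect_dil.
by rewrite !sect_dil_neq0 ?r_gt0 // mulr0.
Qed.
HB.instance Definition _ d := GRing.isMonoidMorphism.Build
  (pseries R) (pseries R) (@dil R d) (@dil_is_monoid_morphism d).

Lemma dil_dil a b f : (0 < a)%N -> dil a (dil b f) = dil (a * b) f.
Proof.
move=> a_gt0; apply/pseriesP => n /=.
case: (boolP (a %| n)%N) => [/dvdnP[c ->]|a'n].
  by rewrite mulnK // [(c * a)%N]mulnC dvdn_pmul2l // divnMl.
case: ifP => // abn; case/negP: a'n; apply: dvdn_trans abn.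
exact: dvdn_mulr.
Qed.

Lemma dil1 f : dil 1 f = f.
Proof. by apply/pseriesP => n /=; rewrite dvd1n divn1. Qed.

Lemma dil_psq d : (0 < d)%N -> dil d psq = psq ^+ d :> pseries R.
Proof.
move=> d_gt0; apply/pseriesP => n; rewrite coef_psqXn /=.
case: (boolP (d %| n)%N) => [/dvdnP[c ->]|d'n].
  by rewrite mulnK //= -{2}[d]mul1n eqn_pmul2r.
by case: eqP d'n => // ->; rewrite dvdnn.
Qed.

Lemma sect_psqX d r m : (r < d)%N ->
  sect d r (psq ^+ m) = (if (m %% d)%N == r then psq ^+ (m %/ d) else 0)
  :> pseries R.
Proof.
move=> ltrd; have d_gt0 : (0 < d)%N by apply: leq_ltn_trans ltrd.
apply/pseriesP => n; rewrite /= coef_psqXn.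
have -> : (d * n + r == m)%N = (m %% d == r)%N && (n == m %/ d)%N.
  apply/eqP/andP => [<-|[/eqP <- /eqP ->]]; last by rewrite mulnC -divn_eq.
  by rewrite mulnC modnMDl modn_small // divnMDl // divn_small // addn0 !eqxx.
by case: ifP => // _; rewrite coef_psqXn.
Qed.

Lemma sect_decomp d f : (0 < d)%N ->
  f = \sum_(i < d) psq ^+ i * dil d (sect d i f).
Proof.
move=> d_gt0; apply: (@sectP d) => // r ltrd; rewrite raddf_sum /=.
rewrite (bigD1 (Ordinal ltrd)) //= mulrC sect_dilM //.
rewrite sect_psqX // modn_small // eqxx divn_small // mulr1 big1 ?addr0 //.
move=> i; rewrite -val_eqE /= => ne_ir.
by rewrite mulrC sect_dilM // sect_psqX // modn_small // (negPf ne_ir) mulr0.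
Qed.

Lemma sect_conv d r f g : (r < d)%N ->
  sect d r (f * g) = \sum_(i < d) \sum_(j < d)
    sect d i f * sect d j g * sect d r (psq ^+ (i + j)).
Proof.
move=> ltrd; have d_gt0 : (0 < d)%N by apply: leq_ltn_trans ltrd.
rewrite {1}(sect_decomp f d_gt0) {1}(sect_decomp g d_gt0).
rewrite mulr_suml raddf_sum; apply: eq_bigr => i _.
rewrite mulr_sumr raddf_sum; apply: eq_bigr => j _ /=.
by rewrite -sect_dilM // rmorphM exprD /=; congr sect; ring.
Qed.

(** The product of series graded by the exponent modulo 5, with a factor q for
    each carry. *)
Lemma sect5M f g :
  ((f * g)`_[0] = f`_[0] * g`_[0] + psq * (f`_[1] * g`_[4] + f`_[2] * g`_[3]
      + f`_[3] * g`_[2] + f`_[4] * g`_[1])) *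
  ((f * g)`_[1] = f`_[0] * g`_[1] + f`_[1] * g`_[0]
      + psq * (f`_[2] * g`_[4] + f`_[3] * g`_[3] + f`_[4] * g`_[2])) *
  ((f * g)`_[2] = f`_[0] * g`_[2] + f`_[1] * g`_[1] + f`_[2] * g`_[0]
      + psq * (f`_[3] * g`_[4] + f`_[4] * g`_[3])) *
  ((f * g)`_[3] = f`_[0] * g`_[3] + f`_[1] * g`_[2] + f`_[2] * g`_[1]
      + f`_[3] * g`_[0] + psq * (f`_[4] * g`_[4])) *
  ((f * g)`_[4] = f`_[0] * g`_[4] + f`_[1] * g`_[3] + f`_[2] * g`_[2]
      + f`_[3] * g`_[1] + f`_[4] * g`_[0]).
Proof.
by do !split; rewrite sect_conv // !big_ord_recr !big_ord0 /=;
   rewrite !sect_psqX //= ?divnn ?expr0 ?expr1; ring.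
Qed.

End Dilation.

(** * Agreement of initial coefficients *)

Section Agree.
Variable R : comNzRingType.
Implicit Types f g h : pseries R.

(** Congruence modulo q^N.  Infinite products and sums are handled through
    their finite truncations, with which they agree to any given order. *)
Definition agree (N : nat) f g := forall n, (n < N)%N -> f n = g n.

Lemma agree_refl N f : agree N f f. Proof. by []. Qed.
Lemma agree_sym N f g : agree N f g -> agree N g f.
Proof. by move=> fg n ltnN; rewrite fg. Qed.
Lemma agree_trans N f g h : agree N f g -> agree N g h -> agree N f h.
Proof. by move=> fg gh n ltnN; rewrite fg // gh. Qed.
Lemma agree_le N M f g : (M <= N)%N -> agree N f g -> agree M f g.
Proof. by move=> leMN fg n ltnM; apply: fg; apply: leq_trans leMN. Qed.
Lemma agreeP f g : (forall N, agree N f g) -> f = g.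
Proof. by move=> fg; apply/pseriesP => n; apply: (fg n.+1). Qed.
Lemma agreeD N f f' g g' :
  agree N f f' -> agree N g g' -> agree N (f + g) (f' + g').
Proof. by move=> ff' gg' n ltnN; rewrite !coefpsD ff' // gg'. Qed.
Lemma agreeN N f g : agree N f g -> agree N (- f) (- g).
Proof. by move=> fg n ltnN; rewrite !coefpsN fg. Qed.
Lemma agreeM N f f' g g' :
  agree N f f' -> agree N g g' -> agree N (f * g) (f' * g').
Proof.
move=> ff' gg' n ltnN; rewrite !coefpsM; apply: eq_bigr => i _.
have leiN : (i < N)%N by apply: leq_ltn_trans ltnN; rewrite -ltnS.
by rewrite ff' // gg' // (leq_ltn_trans (leq_subr _ _) ltnN).
Qed.
Lemma agreeX N f g m : agree N f g -> agree N (f ^+ m) (g ^+ m).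
Proof. by move=> fg; elim: m => // m IH; rewrite !exprS; apply: agreeM. Qed.
Lemma agree_prod N (I : Type) (r : seq I) (P : pred I) (F G : I -> pseries R) :
  (forall i, P i -> agree N (F i) (G i)) ->
  agree N (\prod_(i <- r | P i) F i) (\prod_(i <- r | P i) G i).
Proof. by move=> FG; elim/big_ind2: _ => // *; apply: agreeM. Qed.
Lemma agree_psqXnM N m f g : (N <= m)%N -> agree N (g + psq ^+ m * f) g.
Proof.
move=> leNm n ltnN; rewrite coefpsD coef_psqXnM.
by rewrite (leq_trans ltnN leNm) addr0.
Qed.
Lemma agree_dil N d f g : (0 < d)%N -> agree N f g -> agree N (dil d f) (dil d g).
Proof.
move=> d_gt0 fg n ltnN /=; case: ifP => // _; apply: fg.
exact: leq_ltn_trans (leq_div _ _) ltnN.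
Qed.
Lemma agree_sect N d r f g : (r < d)%N ->
  agree (d * N) f g -> agree N (sect d r f) (sect d r g).
Proof. by move=> ltrd fg n ltnN /=; apply: fg; nia. Qed.

End Agree.

(** * Cancellation, change of coefficients, and twists *)

Section Domain.
Variable R : idomainType.
Implicit Types f g h : pseries R.

Lemma ps_mul_eq0 f g : f 0%N != 0 -> f * g = 0 -> g = 0.
Proof.
move=> f0 fg0; apply/pseriesP => n; elim/ltn_ind: n => n IH.
have /pseriesP/(_ n) := fg0; rewrite coefpsM big_ord_recl subn0 big1.
  by rewrite addr0 coefps0 => /eqP; rewrite mulf_eq0 (negPf f0) => /eqP.
move=> i _; rewrite IH ?mulr0 //; rewrite /= /bump /= add1n.
by case: n i {IH} => [[]|n i] //; rewrite subSS ltnS leq_subr.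
Qed.

Lemma ps_mulfI f : f 0%N != 0 -> injective ( *%R f).
Proof.
move=> f0 g h /eqP; rewrite -subr_eq0 -mulrBr => /eqP/(ps_mul_eq0 f0)/eqP.
by rewrite subr_eq0 => /eqP.
Qed.

End Domain.

Section Morphisms.
Variables (R S : comNzRingType) (phi : {rmorphism R -> S}).

Definition map_ps (f : pseries R) : pseries S := PSeries (fun n => phi (f n)).

Lemma map_ps_is_zmod_morphism : zmod_morphism map_ps.
Proof. by move=> f g; apply/pseriesP => n; rewrite /= rmorphB. Qed.
HB.instance Definition _ := GRing.isZmodMorphism.Build
  (pseries R) (pseries S) map_ps map_ps_is_zmod_morphism.
Lemma map_ps_is_monoid_morphism : monoid_morphism map_ps.
Proof.
split=> [|f g]; apply/pseriesP => n; first by rewrite /= rmorph_nat.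
by rewrite coefpsM /= rmorph_sum; apply: eq_bigr => i _; rewrite rmorphM.
Qed.
HB.instance Definition _ := GRing.isMonoidMorphism.Build
  (pseries R) (pseries S) map_ps map_ps_is_monoid_morphism.

Lemma map_ps_dil d f : map_ps (dil d f) = dil d (map_ps f).
Proof. by apply/pseriesP => n /=; case: ifP => // _; rewrite rmorph0. Qed.
Lemma map_psq : map_ps psq = psq.
Proof. by apply/pseriesP => n /=; rewrite rmorph_nat. Qed.
Lemma map_ps_inj : injective phi -> injective map_ps.
Proof.
by move=> phi_inj f g /pseriesP fg; apply/pseriesP => n; apply/phi_inj/fg.
Qed.
Lemma agree_map N f g : agree N f g -> agree N (map_ps f) (map_ps g).
Proof. by move=> fg n ltnN /=; rewrite fg. Qed.

End Morphisms.

Section Twist.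
Variables (R : comNzRingType).
Implicit Types (c : R) (f g : pseries R).

(** The substitution q -> c q. *)
Definition twist c f : pseries R := PSeries (fun n => c ^+ n * f n).

Lemma twist_is_zmod_morphism c : zmod_morphism (twist c).
Proof. by move=> f g; apply/pseriesP => n; rewrite /= mulrBr. Qed.
HB.instance Definition _ c := GRing.isZmodMorphism.Build
  (pseries R) (pseries R) (twist c) (twist_is_zmod_morphism c).
Lemma twist_is_monoid_morphism c : monoid_morphism (twist c).
Proof.
split=> [|f g]; apply/pseriesP => n /=.
  by case: n => [|n]; rewrite ?mulr1 ?mulr0.
rewrite mulr_sumr; apply: eq_bigr => i _ /=.
by rewrite mulrACA -exprD subnKC // -ltnS.
Qed.
HB.instance Definition _ c := GRing.isMonoidMorphism.Build
  (pseries R) (pseries R) (twist c) (twist_is_monoid_morphism c).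

Lemma agree_twist N c f g : agree N f g -> agree N (twist c f) (twist c g).
Proof. by move=> fg n ltnN /=; rewrite fg. Qed.

Lemma twist_dil d c f : (0 < d)%N ->
  twist c (dil d f) = dil d (twist (c ^+ d) f).
Proof.
move=> d_gt0; apply/pseriesP => n /=; case: ifP => [dn|_]; last exact: mulr0.
by rewrite -exprM mulnC divnK.
Qed.

Lemma twist1 f : twist 1 f = f.
Proof. by apply/pseriesP => n /=; rewrite expr1n mul1r. Qed.

Definition psC c : pseries R := PSeries (fun n => if n == 0%N then c else 0).

Lemma coef_psCM c f n : (psC c * f) n = c * f n.
Proof.
rewrite coefpsM big_ord_recl subn0 big1 ?addr0 // => i _.
exact: mul0r.
Qed.

Lemma twist_psqX c m : twist c (psq ^+ m) = psC (c ^+ m) * psq ^+ m.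
Proof.
apply/pseriesP => n; rewrite coef_psCM /= coef_psqXn.
by case: eqP => [->|]; rewrite ?mulr0.
Qed.

Lemma psC_is_zmod_morphism : zmod_morphism psC.
Proof.
by move=> a b; apply/pseriesP => n; rewrite coefpsB /=; case: eqP; rewrite ?subr0.
Qed.
HB.instance Definition _ := GRing.isZmodMorphism.Build
  R (pseries R) psC psC_is_zmod_morphism.
Lemma psC_is_monoid_morphism : monoid_morphism psC.
Proof.
split=> [|a b]; apply/pseriesP => n; rewrite ?coef_psCM /=.
  by case: eqP.
by case: eqP => //; rewrite mulr0.
Qed.
HB.instance Definition _ := GRing.isMonoidMorphism.Build
  R (pseries R) psC psC_is_monoid_morphism.

End Twist.

(** * Two finite identities of Shanks *)

Section FiniteIdentities.
Variables (R : comNzRingType) (q : R).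

(** The pairs of exponents m(3m+1)/2 and (m+1)(3m+2)/2 are written without
    division.  With this grouping, section 1 modulo 5 of a sum of 5n pairs is,
    up to sign and dilation, exactly a sum of n pairs. *)
Definition pent_sum n : R := \sum_(m < n) (-1) ^+ m *
  (q ^+ (m ^ 2 + 'C(m.+1, 2)) - q ^+ (m.+1 ^ 2 + 'C(m.+1, 2))).

Definition tri_sum n : R := \sum_(m < n) q ^+ 'C(m.+1, 2).

(** Every term with s > 0 on the left is divisible by q^n, so modulo q^n only
    the product of the 1 - q^i for i <= n is left: the limit is the pentagonal
    number theorem. *)
Lemma shanks_pentagonal n :
  \sum_(s < n.+1) (-1) ^+ s * q ^+ (s * n + 'C(s.+1, 2))
      * \prod_(s <= i < n) (1 - q ^+ i.+1)
  = pent_sum n + (-1) ^+ n * q ^+ (n ^ 2 + 'C(n.+1, 2)).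
Proof.
elim: n => [|n IH].
  by rewrite big_ord1 /pent_sum big_ord0 big_geq // !expr0; ring.
(* The terms for n + 1 are those for n up to the telescoping sum of u. *)
pose t s := (-1) ^+ s * q ^+ (s * n + 'C(s.+1, 2))
            * \prod_(s <= i < n) (1 - q ^+ i.+1).
pose u s := (-1) ^+ s * q ^+ (s * n.+1 + 'C(s.+1, 2)) * q ^+ n.+1
            * \prod_(s <= i < n) (1 - q ^+ i.+1).
have step (s : nat) : (s < n)%N ->
  (-1) ^+ s.+1 * q ^+ (s.+1 * n.+1 + 'C(s.+2, 2))
      * \prod_(s.+1 <= i < n.+1) (1 - q ^+ i.+1) = t s.+1 + u s - u s.+1.
  move=> ltsn; rewrite /t /u (@big_ltn _ _ _ s n) // big_nat_recr //=.
  have -> : (s.+1 * n.+1 + 'C(s.+2, 2) = (s.+1 * n + 'C(s.+2, 2)) + s.+1)%N.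
    by rewrite mulnS; lia.
  have e2 : (s.+1 * n + 'C(s.+2, 2) = (s * n.+1 + 'C(s.+1, 2)) + n.+1)%N.
    by rewrite [in LHS]binS bin1 mulnS mulSn; lia.
  by rewrite e2 !exprD [(-1) ^+ s.+1]exprS; ring.
rewrite big_ord_recl big_ord_recr /= /bump /= add0n.
rewrite (eq_bigr (fun s : 'I_n => t s.+1 + (u s - u s.+1))); last first.
  by move=> s _; rewrite step // addrA.
rewrite big_split /= -(big_mkord xpredT (fun s => u s - u s.+1)).
have -> : \sum_(0 <= s < n) (u s - u s.+1) = u 0 - u n.
  rewrite -[RHS]opprB -(telescope_sumr u (leq0n n)) -sumrN.
  by apply: eq_bigr => s _; rewrite opprB.
have -> : \sum_(i < n) t i.+1 =
   pent_sum n + (-1) ^+ n * q ^+ (n ^ 2 + 'C(n.+1, 2)) - t 0%N.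
  rewrite -IH big_ord_recl /= -/(t 0%N) addrC addKr.
  by apply: eq_bigr => s _; rewrite /bump add1n.
rewrite [pent_sum n.+1]big_ord_recr /= -/(pent_sum n) /t /u.
rewrite !mul0n !add0n !(@bin_small 1 2) // !expr0 !add1n big_nat_recr //=.
rewrite (@big_geq _ _ _ n n) // (@big_geq _ _ _ n.+1) //.
have -> : (n * n.+1 + 'C(n.+1, 2) = n ^ 2 + 'C(n.+1, 2) + n)%N.
  by rewrite mulnS -mulnn; lia.
have -> : (n.+1 * n.+1 + 'C(n.+2, 2) = n ^ 2 + 'C(n.+1, 2) + n + n.+1 + n.+1)%N.
  by rewrite [in LHS]binS bin1 -mulnn mulSn mulnS; lia.
have -> : (n.+1 ^ 2 + 'C(n.+1, 2) = n ^ 2 + 'C(n.+1, 2) + n + n.+1)%N.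
  by rewrite -!mulnn mulSn mulnS; lia.
rewrite !exprD [(-1) ^+ n.+1]exprS; ring.
Qed.

(** Modulo q^n the left-hand side reduces to its term s = 0, the product of the
    1 - q^(2i), and the identity becomes Gauss's formula
    E_2 = (q; q^2)_oo * (sum of the q^(n(n+1)/2)). *)
Lemma shanks_triangular n :
  \sum_(s < n) \prod_(s <= i < n) (1 - q ^+ (2 * i.+1))
      * \prod_(i < s) (1 - q ^+ (2 * i).+1) * q ^+ (s * (2 * n).+1)
  = \prod_(i < n) (1 - q ^+ (2 * i).+1) * tri_sum (2 * n).
Proof.
elim: n => [|n IH]; first by rewrite !big_ord0 /tri_sum big_ord0 mulr0.
pose t s := \prod_(s <= i < n) (1 - q ^+ (2 * i.+1))
            * \prod_(i < s) (1 - q ^+ (2 * i).+1).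
have q2 m : q ^+ (2 * m) = q ^+ m * q ^+ m by rewrite mul2n -addnn exprD.
pose u s := t s * (1 - q ^+ (2 * s)) * q ^+ (s * (2 * n).+1).
have step (s : nat) : (s < n)%N ->
  \prod_(s <= i < n.+1) (1 - q ^+ (2 * i.+1))
      * \prod_(i < s) (1 - q ^+ (2 * i).+1) * q ^+ (s * (2 * n.+1).+1)
  = (1 - q ^+ (2 * n).+1) * (t s * q ^+ (s * (2 * n).+1)) + (u s.+1 - u s).
  move=> ltsn; rewrite /u /t [in RHS]big_ord_recr /=.
  rewrite (big_nat_recr n) /=; last exact: ltnW.
  rewrite (@big_ltn _ _ _ s n) //.
  have -> : (s * (2 * n.+1).+1 = s * (2 * n).+1 + 2 * s)%N by nia.
  have -> : (s.+1 * (2 * n).+1 = s * (2 * n).+1 + 2 * n + 1)%N by nia.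
  rewrite !mulnS !add2n !exprD !exprS (q2 s) (q2 n) expr0; ring.
rewrite big_ord_recr /=.
rewrite (eq_bigr (fun s : 'I_n => (1 - q ^+ (2 * n).+1)
   * (t s * q ^+ (s * (2 * n).+1)) + (u s.+1 - u s))); last first.
  by move=> s _; rewrite step.
rewrite big_split /= -mulr_sumr IH -(big_mkord xpredT (fun s => u s.+1 - u s)).
rewrite telescope_sumr // {2}/u muln0 expr0 subrr mulr0 mul0r subr0.
have e2n : (2 * n.+1 = (2 * n).+2)%N by rewrite mulnS.
rewrite /u /t big_geq // big_nat1 big_ord_recr /= e2n.
rewrite /tri_sum !big_ord_recr /=.
have binC2 : ('C((2 * n).+1, 2) = n * (2 * n).+1)%N.
  by rewrite bin2 /= mulnC -mulnA mul2n doubleK mulnC.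
rewrite binC2.
have -> : ('C((2 * n).+2, 2) = n * (2 * n).+1 + (2 * n).+1)%N.
  by rewrite binS bin1 binC2.
have -> : (n * (2 * n).+3 = n * (2 * n).+1 + 2 * n)%N by nia.
rewrite !exprD !exprS (q2 n) ?expr0; ring.
Qed.

Lemma prod_split_parity (F : nat -> R) n :
  \prod_(i < 2 * n) F i = \prod_(i < n) F (2 * i)%N * \prod_(i < n) F (2 * i).+1.
Proof.
elim: n => [|n IH]; first by rewrite muln0 !big_ord0 mulr1.
rewrite mulnS add2n !big_ord_recr IH /= -!mulrA; congr (_ * _).
by rewrite mulrCA.
Qed.

End FiniteIdentities.

(** * Euler's product *)

Section PolySeries.
Variable R : comNzRingType.

Definition ps_of_poly (p : {poly R}) : pseries R := PSeries (fun n => p`_n).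

Lemma ps_of_poly_is_zmod_morphism : zmod_morphism ps_of_poly.
Proof. by move=> p r; apply/pseriesP => n; rewrite /= coefB. Qed.
HB.instance Definition _ := GRing.isZmodMorphism.Build
  {poly R} (pseries R) ps_of_poly ps_of_poly_is_zmod_morphism.
Lemma ps_of_poly_is_monoid_morphism : monoid_morphism ps_of_poly.
Proof.
by split=> [|p r]; apply/pseriesP => n; [rewrite /= coef1 | rewrite /= coefM].
Qed.
HB.instance Definition _ := GRing.isMonoidMorphism.Build
  {poly R} (pseries R) ps_of_poly ps_of_poly_is_monoid_morphism.

Lemma ps_of_polyX : ps_of_poly 'X = psq.
Proof. by apply/pseriesP => n; rewrite /= coefX. Qed.

Definition eul_prod (d N : nat) : pseries R :=
  \prod_(i < N) (1 - psq ^+ (d * i.+1)).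

Lemma dil_eul_prod d e N : (0 < d)%N ->
  dil d (eul_prod e N) = eul_prod (d * e) N.
Proof.
move=> d_gt0; rewrite rmorph_prod; apply: eq_bigr => i _.
by rewrite rmorphB rmorph1 rmorphXn /= dil_psq // -exprM mulnA.
Qed.

Lemma agree_sum0 N (I : Type) (r : seq I) (P : pred I) (F : I -> pseries R) :
  (forall i, P i -> agree N (F i) 0) -> agree N (\sum_(i <- r | P i) F i) 0.
Proof.
move=> F0; elim/big_ind: _ => // f g f0 g0.
by rewrite -[0]addr0; apply: agreeD.
Qed.

Lemma agree_psqXn0 N m (f : pseries R) : (N <= m)%N -> agree N (psq ^+ m * f) 0.
Proof. by move=> leNm; rewrite -[_ * f]add0r; apply: agree_psqXnM. Qed.

Lemma agree_eul_prod_pent n :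
  agree n (eul_prod 1 n) (pent_sum (psq : pseries R) n).
Proof.
have := shanks_pentagonal (psq : pseries R) n.
rewrite big_ord_recl expr0 (@bin_small 1 2) // mul0n expr0 !mul1r big_mkord.
move=> def_sum; apply: (@agree_trans _ _ _ (pent_sum psq n
   + (-1) ^+ n * psq ^+ (n ^ 2 + 'C(n.+1, 2)))); last first.
  rewrite mulrC; apply: agree_psqXnM; case: n {def_sum} => // n.
  by rewrite -mulnn mulSn -!addnA leq_addr.
rewrite -def_sum; have -> : eul_prod 1 n = \prod_(i < n) (1 - psq ^+ i.+1) + 0.
  by rewrite addr0; apply: eq_bigr => i _; rewrite mul1n.
apply: agreeD => //; apply: agree_sym.
apply: agree_sum0 => i _; rewrite mulrAC mulrC; apply: agree_psqXn0.
by rewrite lift0 mulSn -addnA leq_addr.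
Qed.

Lemma agree_eul_prod_tri n :
  agree n (eul_prod 2 n ^+ 2) (eul_prod 1 (2 * n) * tri_sum psq (2 * n)).
Proof.
have := shanks_triangular (psq : pseries R) n.
set O := \prod_(i < n) _ => def_sum.
have -> : eul_prod 1 (2 * n) = O * eul_prod 2 n.
  rewrite /eul_prod (prod_split_parity (fun i => 1 - psq ^+ (1 * i.+1))); congr (_ * _).
    by apply: eq_bigr => i _; rewrite mul1n.
  by apply: eq_bigr => i _; rewrite mul1n mulnS add2n.
rewrite mulrAC -def_sum expr2; clear def_sum O; apply: agreeM => //.
case: n => [|n]; first by [].
rewrite big_ord_recl big_ord0 mulr1 mul0n expr0 mulr1 big_mkord.
rewrite -[eul_prod 2 _]addr0; apply: agreeD => //; apply: agree_sym.
apply: agree_sum0 => i _; rewrite mulrC; apply: agree_psqXn0.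
rewrite lift0 mulSn; lia.
Qed.

End PolySeries.

(** The series (q; q)_oo; the other products (q^d; q^d)_oo are its dilations, by
    [qpoch_dil]. *)
Definition eul : pseries int := PSeries (qpoch 1 1).

Lemma qpoch_trunc_ps a b N :
  ps_of_poly (qpoch_trunc a b N) = \prod_(j < N) (1 - psq ^+ (a + b * j)).
Proof.
rewrite /qpoch_trunc big_mkord rmorph_prod; apply: eq_bigr => i _.
by rewrite rmorphB rmorph1 rmorphXn /= ps_of_polyX.
Qed.

Lemma agree_qpoch d N : (0 < d)%N ->
  agree N (PSeries (qpoch d d)) (eul_prod _ d N).
Proof.
move=> d_gt0 n ltnN; rewrite /= -(qpoch_stable d_gt0 d_gt0 ltnN).
have /pseriesP/(_ n) /= -> := qpoch_trunc_ps d d N.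
by congr (pscoef _ n); apply: eq_bigr => i _; rewrite mulnS.
Qed.

Lemma agree_eul N : agree N eul (eul_prod _ 1 N).
Proof. exact: agree_qpoch. Qed.

Lemma qpoch_dil d : (0 < d)%N -> PSeries (qpoch d d) = dil d eul.
Proof.
move=> d_gt0; apply: agreeP => N; have dN := @agree_qpoch d N d_gt0.
have eulN := agree_dil d_gt0 (@agree_eul N).
rewrite dil_eul_prod // muln1 in eulN.
exact: agree_trans dN (agree_sym eulN).
Qed.

Lemma eul0 : eul 0%N = 1. Proof. exact: qpoch0. Qed.

Lemma agree_eul_pent N : agree N eul (pent_sum psq N).
Proof. exact: agree_trans (@agree_eul N) (@agree_eul_prod_pent _ N). Qed.

(** * Pentagonal and triangular sums along residues modulo 5 *)

Lemma big_ord5 (V : Type) (idx : V) (op : Monoid.law idx) n (F : nat -> V) :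
  \big[op/idx]_(m < 5 * n) F m = \big[op/idx]_(t < n)
    op (op (op (op (F (5 * t)%N) (F (5 * t + 1)%N)) (F (5 * t + 2)%N))
      (F (5 * t + 3)%N)) (F (5 * t + 4)%N).
Proof.
elim: n => [|n IH]; first by rewrite !big_ord0.
rewrite (_ : 5 * n.+1 = (5 * n).+4.+1)%N ?mulnS // !big_ord_recr IH /=.
by rewrite !addnS !addn0 !Monoid.mulmA.
Qed.

Lemma sum_ord5 (V : nmodType) n (F : nat -> V) :
  \sum_(m < 5 * n) F m = \sum_(t < n) (F (5 * t)%N + F (5 * t + 1)%N
    + F (5 * t + 2)%N + F (5 * t + 3)%N + F (5 * t + 4)%N).
Proof. exact: big_ord5. Qed.

Lemma bin2E n : (2 * 'C(n.+1, 2) = n.+1 * n)%N.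
Proof. by rewrite bin2 /= mul2n halfK oddM /= andNb subn0. Qed.

Lemma signr_mul5D (R : pzRingType) t a : ~~ odd a ->
  (-1) ^+ (5 * t + a) = (-1) ^+ t :> R.
Proof. by move=> a_even; rewrite -signr_odd oddD oddM (negPf a_even) addbF signr_odd. Qed.

Lemma sect_sign (R : comNzRingType) d r m (f : pseries R) :
  sect d r ((-1) ^+ m * f) = (-1) ^+ m * sect d r f.
Proof. by rewrite -signr_odd !mulr_sign; case: odd; rewrite ?raddfN. Qed.

Lemma pent_exp_lo m : (2 * (m ^ 2 + 'C(m.+1, 2)) = 3 * m ^ 2 + m)%N.
Proof. by rewrite mulnDr bin2E -mulnn; lia. Qed.

Lemma pent_exp_hi m :
  (2 * (m.+1 ^ 2 + 'C(m.+1, 2)) = 3 * m ^ 2 + 5 * m + 2)%N.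
Proof. by rewrite mulnDr bin2E -!mulnn; lia. Qed.

(** The exponents are known through their doubles, and 2 is invertible modulo
    5. *)
Lemma sect5_psqX0 (R : comNzRingType) r e : (r < 5)%N ->
  (2 * e != 2 * r %[mod 5])%N -> sect 5 r (psq ^+ e) = 0 :> pseries R.
Proof. by move=> ltr5 ne; rewrite sect_psqX //; case: eqP => // er; lia. Qed.

Lemma sect5_psqX1 (R : comNzRingType) a r e : (r < 5)%N -> (e = 5 * a + r)%N ->
  sect 5 r (psq ^+ e) = psq ^+ a :> pseries R.
Proof.
move=> ltr5 ->; rewrite sect_psqX // mulnC modnMDl modn_small // eqxx.
by rewrite divnMDl // divn_small // addn0.
Qed.

Section SectSums.
Variable R : comNzRingType.
Definition pent_term m : pseries R := (-1) ^+ m *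
  (psq ^+ (m ^ 2 + 'C(m.+1, 2)) - psq ^+ (m.+1 ^ 2 + 'C(m.+1, 2))).

Let sect5F r m : sect 5 r (pent_term m) = (-1) ^+ m *
  (sect 5 r (psq ^+ (m ^ 2 + 'C(m.+1, 2)))
   - sect 5 r (psq ^+ (m.+1 ^ 2 + 'C(m.+1, 2)))).
Proof. by rewrite sect_sign sectB. Qed.

Let sect5_lo0 r t a : (r < 5)%N -> (3 * a ^ 2 + a != 2 * r %[mod 5])%N ->
  sect 5 r (psq ^+ ((5 * t + a) ^ 2 + 'C((5 * t + a).+1, 2))) = 0 :> pseries R.
Proof.
move=> ltr5 ne; apply: sect5_psqX0 => //; rewrite pent_exp_lo -!mulnn.
rewrite -mulnn in ne.
have -> : (3 * ((5 * t + a) * (5 * t + a)) + (5 * t + a) =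
  (15 * (t * t) + 6 * (t * a) + t) * 5 + (3 * (a * a) + a))%N by lia.
by rewrite modnMDl.
Qed.

Let sect5_hi0 r t a : (r < 5)%N -> (3 * a ^ 2 + 2 != 2 * r %[mod 5])%N ->
  sect 5 r (psq ^+ ((5 * t + a).+1 ^ 2 + 'C((5 * t + a).+1, 2))) = 0 :> pseries R.
Proof.
move=> ltr5 ne; apply: sect5_psqX0 => //; rewrite pent_exp_hi -!mulnn.
rewrite -mulnn in ne.
have -> : (3 * ((5 * t + a) * (5 * t + a)) + 5 * (5 * t + a) + 2 =
  (15 * (t * t) + 6 * (t * a) + 5 * t + a) * 5 + (3 * (a * a) + 2))%N by lia.
by rewrite modnMDl.
Qed.

Let sect5F0 r t a :
  [&& r < 5, 3 * a ^ 2 + a != 2 * r %[mod 5] & 3 * a ^ 2 + 2 != 2 * r %[mod 5]]%N ->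
  sect 5 r (pent_term (5 * t + a)) = 0.
Proof.
by case/and3P=> *; rewrite sect5F sect5_lo0 // sect5_hi0 // subrr mulr0.
Qed.

Lemma sect5_pent_sum3 n : sect 5 3 (pent_sum psq (5 * n)) = 0 :> pseries R.
Proof.
rewrite /pent_sum (sum_ord5 _ pent_term) raddf_sum big1 //= => t _.
rewrite -[in pent_term (5 * t)%N](addn0 (5 * t)%N) 4!sectD.
transitivity (0 + 0 + 0 + 0 + 0 : pseries R); last by rewrite !addr0.
by congr (_ + _ + _ + _ + _); exact: sect5F0.
Qed.

Lemma sect5_pent_sum4 n : sect 5 4 (pent_sum psq (5 * n)) = 0 :> pseries R.
Proof.
rewrite /pent_sum (sum_ord5 _ pent_term) raddf_sum big1 //= => t _.
rewrite -[in pent_term (5 * t)%N](addn0 (5 * t)%N) 4!sectD.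
transitivity (0 + 0 + 0 + 0 + 0 : pseries R); last by rewrite !addr0.
by congr (_ + _ + _ + _ + _); exact: sect5F0.
Qed.

(** The exponents congruent to 1 modulo 5 are m(3m+1)/2 with m = 5t+4 and
    (m+1)(3m+2)/2 with m = 5t; subtracting 1 gives 25 times a pentagonal
    exponent. *)
Lemma sect5_pent_sum1 n :
  sect 5 1 (pent_sum psq (5 * n)) = - dil 5 (pent_sum psq n) :> pseries R.
Proof.
rewrite /pent_sum (sum_ord5 _ pent_term) raddf_sum rmorph_sum -sumrN.
apply: eq_bigr => t _ /=; rewrite -[in pent_term (5 * t)%N](addn0 (5 * t)%N) 4!sectD.
transitivity ((-1) ^+ (5 * t + 0)
   * (0 - sect 5 1 (psq ^+ ((5 * t + 0).+1 ^ 2 + 'C((5 * t + 0).+1, 2))))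
   + 0 + 0 + 0 + (-1) ^+ (5 * t + 4)
   * (sect 5 1 (psq ^+ ((5 * t + 4) ^ 2 + 'C((5 * t + 4).+1, 2))) - 0) : pseries R).
  congr (_ + _ + _ + _ + _); [|exact: sect5F0|exact: sect5F0|exact: sect5F0|].
    by rewrite sect5F; congr (_ * (_ - _)); exact: sect5_lo0.
  by rewrite sect5F; congr (_ * (_ - _)); exact: sect5_hi0.
have hi : ((5 * t + 0).+1 ^ 2 + 'C((5 * t + 0).+1, 2)
    = 5 * (5 * (t ^ 2 + 'C(t.+1, 2))) + 1)%N.
  have := pent_exp_hi (5 * t); have := pent_exp_lo t; rewrite addn0 -!mulnn; lia.
have lo : ((5 * t + 4) ^ 2 + 'C((5 * t + 4).+1, 2)
    = 5 * (5 * (t.+1 ^ 2 + 'C(t.+1, 2))) + 1)%N.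
  have := pent_exp_lo (5 * t + 4); have := pent_exp_hi t; rewrite -!mulnn; lia.
have lt15 : (1 < 5)%N by [].
rewrite (sect5_psqX1 _ lt15 hi) (sect5_psqX1 _ lt15 lo) !signr_mul5D //.
rewrite rmorphM rmorph_sign rmorphB !rmorphXn /= dil_psq // -!exprM.
by rewrite !exprM; ring.
Qed.

Definition tri_term m : pseries R := psq ^+ 'C(m.+1, 2).

Let sect5_tri0 r t a : (r < 5)%N && (a ^ 2 + a != 2 * r %[mod 5])%N ->
  sect 5 r (tri_term (5 * t + a)) = 0.
Proof.
case/andP=> ltr5 ne; apply: sect5_psqX0 => //; rewrite bin2E.
rewrite -mulnn in ne.
have -> : ((5 * t + a).+1 * (5 * t + a) =
  (5 * (t * t) + 2 * (t * a) + t) * 5 + (a * a + a))%N by lia.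
by rewrite modnMDl.
Qed.

Lemma sect5_tri_sum2 n : sect 5 2 (tri_sum psq (5 * n)) = 0 :> pseries R.
Proof.
rewrite /tri_sum (sum_ord5 _ tri_term) raddf_sum big1 //= => t _.
rewrite -[in tri_term (5 * t)%N](addn0 (5 * t)%N) 4!sectD.
transitivity (0 + 0 + 0 + 0 + 0 : pseries R); last by rewrite !addr0.
by congr (_ + _ + _ + _ + _); exact: sect5_tri0.
Qed.

Lemma sect5_tri_sum4 n : sect 5 4 (tri_sum psq (5 * n)) = 0 :> pseries R.
Proof.
rewrite /tri_sum (sum_ord5 _ tri_term) raddf_sum big1 //= => t _.
rewrite -[in tri_term (5 * t)%N](addn0 (5 * t)%N) 4!sectD.
transitivity (0 + 0 + 0 + 0 + 0 : pseries R); last by rewrite !addr0.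
by congr (_ + _ + _ + _ + _); exact: sect5_tri0.
Qed.

(** A triangular exponent is 3 modulo 5 when m = 5t+2, and it is then 3 plus 25
    times a triangular number. *)
Lemma sect5_tri_sum3 n :
  sect 5 3 (tri_sum psq (5 * n)) = dil 5 (tri_sum psq n) :> pseries R.
Proof.
rewrite /tri_sum (sum_ord5 _ tri_term) raddf_sum rmorph_sum.
apply: eq_bigr => t _ /=; rewrite -[in tri_term (5 * t)%N](addn0 (5 * t)%N) 4!sectD.
transitivity (0 + 0 + sect 5 3 (tri_term (5 * t + 2)) + 0 + 0).
  by congr (_ + _ + _ + _ + _); exact: sect5_tri0.
rewrite !addr0 !add0r.
have e : ('C((5 * t + 2).+1, 2) = 5 * (5 * 'C(t.+1, 2)) + 3)%N.
  by have := bin2E (5 * t + 2); have := bin2E t; lia.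
have lt35 : (3 < 5)%N by [].
by rewrite (sect5_psqX1 _ lt35 e) rmorphXn /= dil_psq // -exprM.
Qed.

End SectSums.

(** * The five sections of E and of psi *)

Lemma sect5_eul1 : sect 5 1 eul = - dil 5 eul.
Proof.
apply: agreeP => N; have eulN := @agree_eul_pent N.
apply: agree_trans (agree_sect (isT : 1 < 5)%N (@agree_eul_pent (5 * N))) _.
by rewrite sect5_pent_sum1; apply/agree_sym/agreeN/agree_dil.
Qed.

Lemma sect5_eul3 : sect 5 3 eul = 0.
Proof.
apply: agreeP => N.
apply: agree_trans (agree_sect (isT : 3 < 5)%N (@agree_eul_pent (5 * N))) _.
by rewrite sect5_pent_sum3.
Qed.

Lemma sect5_eul4 : sect 5 4 eul = 0.
Proof.
apply: agreeP => N.
apply: agree_trans (agree_sect (isT : 4 < 5)%N (@agree_eul_pent (5 * N))) _.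
by rewrite sect5_pent_sum4.
Qed.

Definition ps_inv (f : pseries int) : pseries int := PSeries (fps_inv f).

Lemma ps_mulfV (f : pseries int) : f 0%N = 1 -> f * ps_inv f = 1.
Proof.
move=> f0; rewrite mulrC; apply/pseriesP => n.
exact: (fps_mulVf f0).
Qed.

(** The quotient E_2^2 / E, used below only through [eul_psi] and
    [agree_psi_tri]. *)
Fact psi_subproof : {p : pseries int | eul * p = dil 2 eul ^+ 2}.
Proof.
exists (dil 2 eul ^+ 2 * ps_inv eul).
by rewrite mulrCA ps_mulfV ?mulr1 // eul0.
Qed.

Definition psi : pseries int := sval psi_subproof.

Lemma eul_psi : eul * psi = dil 2 eul ^+ 2.
Proof. exact: svalP psi_subproof. Qed.

Lemma psi0 : psi 0%N = 1.
Proof.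
have /pseriesP/(_ 0%N) := eul_psi.
by rewrite coefpsM0 coefpsX0 dil_coef0 eul0 mul1r expr1n.
Qed.

Lemma agree_psi_tri n : agree n psi (tri_sum psq (2 * n)).
Proof.
have eul2N := agree_dil (isT : 0 < 2)%N (@agree_eul n).
rewrite dil_eul_prod // muln1 in eul2N.
have le_n2n : (n <= 2 * n)%N by rewrite mul2n -addnn leq_addr.
have eulN : agree n eul (eul_prod _ 1 (2 * n)) := agree_le le_n2n (@agree_eul _).
have := agree_trans (agreeX 2 eul2N) (@agree_eul_prod_tri _ n).
move/agree_trans/(_ (agree_sym (agreeM eulN (agree_refl _)))).
move/agreeM/(_ (agree_refl (ps_inv eul))); rewrite -eul_psi mulrAC.
by rewrite [eul * _ * _]mulrAC !ps_mulfV ?mul1r ?eul0.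
Qed.

Lemma agree_psi_tri5 n : agree (5 * n) psi (tri_sum psq (5 * (2 * n))).
Proof. by rewrite mulnCA; apply: agree_psi_tri. Qed.

Lemma sect5_psi2 : sect 5 2 psi = 0.
Proof.
apply: agreeP => N.
apply: agree_trans (agree_sect (isT : 2 < 5)%N (@agree_psi_tri5 N)) _.
by rewrite sect5_tri_sum2.
Qed.

Lemma sect5_psi4 : sect 5 4 psi = 0.
Proof.
apply: agreeP => N.
apply: agree_trans (agree_sect (isT : 4 < 5)%N (@agree_psi_tri5 N)) _.
by rewrite sect5_tri_sum4.
Qed.

Lemma sect5_psi3 : sect 5 3 psi = dil 5 psi.
Proof.
apply: agreeP => N.
apply: agree_trans (agree_sect (isT : 3 < 5)%N (@agree_psi_tri5 N)) _.
by rewrite sect5_tri_sum3; apply/agree_sym/agree_dil => //; apply: agree_psi_tri.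
Qed.

(** * The norm over the five substitutions q -> w q *)

Section FifthRoot.
Variables (R : comNzRingType) (c : R).
Hypothesis cyc : 1 + c + c ^+ 2 + c ^+ 3 + c ^+ 4 = 0.

Lemma fifth_root1 : c ^+ 5 = 1.
Proof.
apply/eqP; rewrite -subr_eq0; apply/eqP.
transitivity ((c - 1) * (1 + c + c ^+ 2 + c ^+ 3 + c ^+ 4)); first by ring.
by rewrite cyc mulr0.
Qed.

Lemma fifth_root_expr n : ~~ (5 %| n)%N ->
  1 + c ^+ n + (c ^+ n) ^+ 2 + (c ^+ n) ^+ 3 + (c ^+ n) ^+ 4 = 0.
Proof.
have c5 := fifth_root1.
rewrite (divn_eq n 5) exprD mulnC exprM c5 expr1n mul1r dvdn_addr ?dvdn_mulr //.
have: (n %% 5 < 5)%N by rewrite ltn_mod.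
case: (n %% 5)%N => [|[|[|[|[|r]]]]] //= _ _.
- transitivity (1 + c ^+ 2 + c ^+ 4 + c ^+ 5 * c + c ^+ 5 * c ^+ 3); first by ring.
  by rewrite c5 -[RHS]cyc; ring.
- transitivity (1 + c ^+ 3 + c ^+ 5 * c + c ^+ 5 * c ^+ 4 + c ^+ 5 * c ^+ 5 * c ^+ 2).
    by ring.
  by rewrite c5 -[RHS]cyc; ring.
transitivity (1 + c ^+ 4 + c ^+ 5 * c ^+ 3 + c ^+ 5 * c ^+ 5 * c ^+ 2
  + c ^+ 5 * c ^+ 5 * c ^+ 5 * c); first by ring.
by rewrite c5 -[RHS]cyc; ring.
Qed.

(** The exponents 0, 1, 3 are the residues that occur in psi.  The factors are
    paired as j, 5 - j, so that only the two real quadratic periods s and t,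
    with s + t = s t = -1, are involved. *)
Lemma fifth_root_norm a b d :
  \prod_(j < 5) (a + c ^+ j * b + (c ^+ j) ^+ 3 * d)
  = a ^+ 5 + b ^+ 5 + d ^+ 5 + 5%:R * (a ^+ 2 * b ^+ 2 * d - a * b * d ^+ 3).
Proof.
have c5 := fifth_root1; set s := c + c ^+ 4; set t := c ^+ 2 + c ^+ 3.
have st : t = - 1 - s by apply/eqP; rewrite -subr_eq0 -cyc /s /t; apply/eqP; ring.
have ss : s ^+ 2 = 1 - s.
  apply/eqP; rewrite -subr_eq0; apply/eqP.
  transitivity (c ^+ 5 * (2%:R + c ^+ 3) + c ^+ 2 + (c + c ^+ 4) - 1).
    by rewrite /s; ring.
  by rewrite c5 -[RHS]cyc; ring.
pose S := a ^+ 2 + b ^+ 2 + d ^+ 2.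
have f14 : (a + c * b + c ^+ 3 * d) * (a + c ^+ 4 * b + (c ^+ 4) ^+ 3 * d)
  = S + s * (a * b) + t * (a * d + b * d).
  transitivity (a ^+ 2 + c ^+ 5 * b ^+ 2 + c ^+ 5 * c ^+ 5 * c ^+ 5 * d ^+ 2
   + (c + c ^+ 4) * (a * b) + (c ^+ 3 + c ^+ 5 * c ^+ 5 * c ^+ 2) * (a * d)
   + (c ^+ 5 * c ^+ 2 + c ^+ 5 * c ^+ 5 * c ^+ 3) * (b * d)); first by ring.
  by rewrite c5 /S /s /t; ring.
have f23 : (a + c ^+ 2 * b + (c ^+ 2) ^+ 3 * d)
    * (a + c ^+ 3 * b + (c ^+ 3) ^+ 3 * d)
  = S + t * (a * b) + s * (a * d + b * d).
  transitivity (a ^+ 2 + c ^+ 5 * b ^+ 2 + c ^+ 5 * c ^+ 5 * c ^+ 5 * d ^+ 2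
   + (c ^+ 2 + c ^+ 3) * (a * b) + (c ^+ 5 * c + c ^+ 5 * c ^+ 4) * (a * d)
   + (c ^+ 5 * c ^+ 4 + c ^+ 5 * c ^+ 5 * c) * (b * d)); first by ring.
  by rewrite c5 /S /s /t; ring.
rewrite !big_ord_recr big_ord0 /= expr0 expr1 expr1n !mul1r.
transitivity ((a + b + d)
  * ((a + c * b + c ^+ 3 * d) * (a + c ^+ 4 * b + (c ^+ 4) ^+ 3 * d))
  * ((a + c ^+ 2 * b + (c ^+ 2) ^+ 3 * d) * (a + c ^+ 3 * b + (c ^+ 3) ^+ 3 * d))).
  by ring.
rewrite f14 f23 st.
transitivity ((a + b + d) * (S ^+ 2 - S * (a * b + a * d + b * d)
  - (s ^+ 2 + s) * ((a * b) ^+ 2 + (a * d + b * d) ^+ 2)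
  + (2%:R * (s ^+ 2 + s) + 1) * (a * b) * (a * d + b * d))); first by ring.
by rewrite ss /S; ring.
Qed.

End FifthRoot.

Section Norm.
Variables (R : comNzRingType) (c : R).
Hypothesis cyc : 1 + c + c ^+ 2 + c ^+ 3 + c ^+ 4 = 0.
Implicit Types f g : pseries R.

(** The norm of a series from q to q^5: the product of its twists by the fifth
    roots of unity. *)
Definition ps_norm f := \prod_(j < 5) twist (c ^+ j) f.

Lemma ps_normM f g : ps_norm (f * g) = ps_norm f * ps_norm g.
Proof. by rewrite -big_split; apply: eq_bigr => j _; rewrite rmorphM. Qed.

Lemma ps_normX f m : ps_norm (f ^+ m) = ps_norm f ^+ m.
Proof.
rewrite /ps_norm -prodrXl; apply: eq_bigr => j _.
by rewrite rmorphXn.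
Qed.

Lemma ps_norm_prod (I : Type) (r : seq I) (P : pred I) (F : I -> pseries R) :
  ps_norm (\prod_(i <- r | P i) F i) = \prod_(i <- r | P i) ps_norm (F i).
Proof.
rewrite exchange_big; apply: eq_bigr => j _.
by rewrite rmorph_prod.
Qed.

Lemma agree_ps_norm N f g : agree N f g -> agree N (ps_norm f) (ps_norm g).
Proof. by move=> fg; apply: agree_prod => j _; apply: agree_twist. Qed.

Let psC_cyc : 1 + psC c + psC c ^+ 2 + psC c ^+ 3 + psC c ^+ 4 = 0.
Proof. by rewrite -!rmorphXn -(rmorph1 (@psC R)) -!rmorphD /= cyc rmorph0. Qed.

Lemma ps_norm_theta (a b d : pseries R) :
  ps_norm (dil 5 a + psq * dil 5 b + psq ^+ 3 * dil 5 d)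
  = dil 5 (a ^+ 5 + psq * b ^+ 5 + psq ^+ 3 * d ^+ 5
      + 5%:R * (psq * a ^+ 2 * b ^+ 2 * d - psq ^+ 2 * a * b * d ^+ 3)).
Proof.
transitivity (\prod_(j < 5) (dil 5 a + psC c ^+ j * (psq * dil 5 b)
   + (psC c ^+ j) ^+ 3 * (psq ^+ 3 * dil 5 d))).
  apply: eq_bigr => j _; rewrite !rmorphD !rmorphM /= !twist_dil //.
  rewrite -exprM mulnC exprM (fifth_root1 cyc) expr1n !twist1.
  rewrite -[psq in twist _ psq]expr1 !twist_psqX expr1 !rmorphXn /=.
  by rewrite !expr1; ring.
rewrite (fifth_root_norm psC_cyc).
rewrite !(rmorphD, rmorphN, rmorphM, rmorphXn, rmorph_nat) /= dil_psq //.
by ring.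
Qed.

Lemma ps_norm_cyc n :
  ps_norm (1 - psq ^+ n) =
  if (5 %| n)%N then (1 - psq ^+ n) ^+ 5 else 1 - psq ^+ (5 * n).
Proof.
have -> : ps_norm (1 - psq ^+ n)
    = \prod_(j < 5) (1 - (psC c ^+ n) ^+ j * psq ^+ n).
  apply: eq_bigr => j _; rewrite rmorphB rmorph1 /= twist_psqX !rmorphXn /=.
  by rewrite -!exprM mulnC.
case: ifPn => [/dvdnP[m ->]|n5].
  rewrite mulnC exprM (fifth_root1 psC_cyc) expr1n.
  by rewrite (eq_bigr (fun=> 1 - psq ^+ (5 * m))) ?prodr_const ?card_ord // => j _;
     rewrite expr1n mul1r.
have := fifth_root_norm (fifth_root_expr psC_cyc n5) 1 (- psq ^+ n) 0.
rewrite (eq_bigr (fun j : 'I_5 => 1 - (psC c ^+ n) ^+ j * psq ^+ n)); last first.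
  by move=> j _; rewrite mulr0 addr0 mulrN.
by move=> ->; rewrite mulnC exprM; ring.
Qed.

(** The norm of 1 - q^i is its fifth power if 5 divides i, and 1 - q^(5i)
    otherwise; the factor on the left completes the latter to all i. *)
Lemma ps_norm_eul_prod L :
  ps_norm (eul_prod R 1 (5 * L)) * eul_prod R 25 L
  = eul_prod R 5 (5 * L) * eul_prod R 5 L ^+ 5.
Proof.
rewrite ps_norm_prod /eul_prod (eq_bigr (fun i : 'I_(5 * L) =>
  if (5 %| i.+1)%N then (1 - psq ^+ i.+1) ^+ 5 else 1 - psq ^+ (5 * i.+1))); last first.
  by move=> i _; rewrite mul1n ps_norm_cyc.
rewrite (@big_ord5 _ _ _ L (fun i =>
  if (5 %| i.+1)%N then (1 - psq ^+ i.+1) ^+ 5 else 1 - psq ^+ (5 * i.+1))).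
rewrite (@big_ord5 _ _ _ L (fun i => 1 - psq ^+ (5 * i.+1))).
rewrite -prodrXl -!big_split /=; apply: eq_bigr => t _.
have nd a : (0 < a < 5)%N -> (5 %| 5 * t + a)%N = false.
  by case/andP=> ? ?; rewrite dvdn_addr ?dvdn_mulr // gtnNdvd.
rewrite -[(5 * t).+1]addn1 -!addnS (nd 1) // (nd 2) // (nd 3) // (nd 4) //.
have -> : (5 * t + 5 = 5 * t.+1)%N by rewrite mulnS addnC.
rewrite dvdn_mulr // (_ : 5 * (5 * t.+1) = 25 * t.+1)%N ?mulnA //.
by ring.
Qed.

End Norm.

Section IntegerCoefficients.
Variable R : numDomainType.

Local Notation emb := (map_ps (intr : {rmorphism int -> R})).

Lemma map_eul_prod d N : emb (eul_prod _ d N) = eul_prod _ d N.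
Proof.
rewrite rmorph_prod; apply: eq_bigr => i _.
by rewrite rmorphB rmorph1 rmorphXn /= map_psq.
Qed.

Lemma agree_emb_eul d N : (0 < d)%N -> agree N (dil d (emb eul)) (eul_prod R d N).
Proof.
move=> d_gt0; rewrite -[d in eul_prod _ d]muln1 -dil_eul_prod //.
apply: agree_dil => //; rewrite -map_eul_prod; apply: agree_map.
exact: agree_eul.
Qed.

End IntegerCoefficients.

Lemma ps_norm_eul (R : numDomainType) (c : R) :
  1 + c + c ^+ 2 + c ^+ 3 + c ^+ 4 = 0 ->
  ps_norm c (map_ps intr eul) * dil 25 (map_ps intr eul)
  = dil 5 (map_ps intr eul) ^+ 6.
Proof.
move=> cyc; apply: agreeP => N; set e := map_ps _ eul.
have leN5 : (N <= 5 * N)%N by rewrite leq_pmull.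
have e1 : agree N e (eul_prod R 1 (5 * N)).
  by rewrite -[e]dil1; apply: agree_le leN5 _; apply: agree_emb_eul.
have e5 : agree N (dil 5 e) (eul_prod R 5 (5 * N)).
  by apply: agree_le leN5 _; apply: agree_emb_eul.
have e5' : agree N (dil 5 e) (eul_prod R 5 N) by apply: agree_emb_eul.
have e25 : agree N (dil 25 e) (eul_prod R 25 N) by apply: agree_emb_eul.
apply: agree_trans (agreeM (agree_ps_norm c e1) e25) _.
rewrite ps_norm_eul_prod // [dil 5 e ^+ 6]exprS; apply: agree_sym.
by apply: agreeM => //; apply: agreeX.
Qed.

Lemma ps_norm_dil2 (R : comNzRingType) (c : R) (f : pseries R) :
  ps_norm c (dil 2 f) = dil 2 (ps_norm (c ^+ 2) f).
Proof.
rewrite rmorph_prod; apply: eq_bigr => j _.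
by rewrite twist_dil // -!exprM mulnC.
Qed.

Lemma emb0 (R : numDomainType) (f : pseries int) d :
  f 0%N = 1 -> dil d (map_ps (intr : {rmorphism int -> R}) f) 0%N != 0.
Proof. by move=> f0; rewrite dil_coef0 /= f0 oner_eq0. Qed.

(** The quotient E_2^2 / E transfers [ps_norm_eul] to psi.  The twists of E_2 by
    the powers of c are the dilated twists of E by the powers of c^2, another
    primitive fifth root. *)
Lemma ps_norm_psi (R : numDomainType) (c : R) :
  1 + c + c ^+ 2 + c ^+ 3 + c ^+ 4 = 0 ->
  ps_norm c (map_ps intr psi) * dil 25 (map_ps intr psi)
  = dil 5 (map_ps intr psi) ^+ 6.
Proof.
move=> cyc; set p := map_ps _ psi; set e := map_ps (intr : {rmorphism int -> R}) eul.
have ep : e * p = dil 2 e ^+ 2.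
  by rewrite /e /p -rmorphM eul_psi rmorphXn /= map_ps_dil.
have c2 : 1 + c ^+ 2 + (c ^+ 2) ^+ 2 + (c ^+ 2) ^+ 3 + (c ^+ 2) ^+ 4 = 0.
  exact: fifth_root_expr.
have ne := ps_norm_eul cyc; have ne2 := ps_norm_eul c2.
rewrite -/e in ne ne2.
have np : ps_norm c e * ps_norm c p = dil 2 (ps_norm (c ^+ 2) e) ^+ 2.
  by rewrite -ps_normM ep ps_normX ps_norm_dil2.
have ep5 : dil 5 e * dil 5 p = dil 10 e ^+ 2.
  by rewrite -rmorphM ep rmorphXn /= dil_dil.
have ep25 : dil 25 e * dil 25 p = dil 50 e ^+ 2.
  by rewrite -rmorphM ep rmorphXn /= dil_dil.
have ne2' : dil 2 (ps_norm (c ^+ 2) e) * dil 50 e = dil 10 e ^+ 6.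
  by have := congr1 (dil 2) ne2; rewrite rmorphM rmorphXn /= !dil_dil.
have nz m : dil m e 0%N != 0 by apply: emb0; rewrite eul0.
apply: (@ps_mulfI _ (dil 5 e ^+ 6 * dil 25 e)).
  by rewrite coefpsM0 coefpsX0 mulf_neq0 ?expf_neq0 ?nz.
transitivity ((dil 5 e * dil 5 p) ^+ 6 * dil 25 e); last by ring.
transitivity (ps_norm c e * ps_norm c p * (dil 25 e * dil 25 p) * dil 25 e).
  by rewrite -ne; ring.
rewrite np ep25 ep5.
transitivity ((dil 2 (ps_norm (c ^+ 2) e) * dil 50 e) ^+ 2 * dil 25 e).
  by ring.
by rewrite ne2'; ring.
Qed.

(** * Parametrization at level 10 *)

Section Build.
Variable R : comNzRingType.
Implicit Types f : pseries R.

(** The series whose sections modulo 5 are f0, ..., f4. *)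
Definition build5 f0 f1 f2 f3 f4 : pseries R :=
  dil 5 f0 + psq * dil 5 f1 + psq ^+ 2 * dil 5 f2 + psq ^+ 3 * dil 5 f3
  + psq ^+ 4 * dil 5 f4.

Lemma sect5_build f0 f1 f2 f3 f4 :
  ((build5 f0 f1 f2 f3 f4)`_[0] = f0) * ((build5 f0 f1 f2 f3 f4)`_[1] = f1)
  * ((build5 f0 f1 f2 f3 f4)`_[2] = f2) * ((build5 f0 f1 f2 f3 f4)`_[3] = f3)
  * ((build5 f0 f1 f2 f3 f4)`_[4] = f4).
Proof.
have E r i f : (r < 5)%N -> (i < 5)%N ->
    sect 5 r (psq ^+ i * dil 5 f) = if i == r then f else 0.
  move=> ltr lti; rewrite mulrC sect_dilM // sect_psqX // modn_small //.
  by rewrite divn_small //; case: eqP; rewrite ?mulr1 ?mulr0.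
have F r : (r < 5)%N -> sect 5 r (build5 f0 f1 f2 f3 f4)
    = (if 0%N == r then f0 else 0) + (if 1%N == r then f1 else 0)
      + (if 2 == r then f2 else 0) + (if 3 == r then f3 else 0)
      + (if 4 == r then f4 else 0).
  move=> ltr; rewrite /build5 -[dil 5 f0]mul1r -(expr0 psq) -[X in X * dil 5 f1]expr1.
  by rewrite !sectD !E.
by do !split; rewrite F //= ?addr0 ?add0r.
Qed.

Lemma build5E f : f = build5 f`_[0] f`_[1] f`_[2] f`_[3] f`_[4].
Proof.
rewrite {1}(@sect_decomp _ 5 f) // !big_ord_recr big_ord0 /=.
by rewrite /build5 expr0 expr1; ring.
Qed.

End Build.

Lemma ps_cancel (f g h : pseries int) : f 0%N = 1 -> f * g = f * h -> g = h.
Proof. by move=> f0; apply: ps_mulfI; rewrite f0. Qed.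

Lemma ps_natI (m : nat) (f g : pseries int) : (0 < m)%N ->
  m%:R * f = m%:R * g -> f = g.
Proof.
move=> m_gt0 /pseriesP fg; apply/pseriesP => n.
have := fg n; rewrite !coefps_natl; apply: mulfI.
by rewrite pnatr_eq0 -lt0n.
Qed.

(** Over the integers f^2 + f g + g^2 has constant term 3, hence is regular. *)
Lemma ps_cube_inj (f g : pseries int) : f 0%N = 1 -> g 0%N = 1 ->
  f ^+ 3 = g ^+ 3 -> f = g.
Proof.
move=> f0 g0 fg; apply/eqP; rewrite -subr_eq0; apply/eqP.
apply: (@ps_mul_eq0 _ (f ^+ 2 + f * g + g ^+ 2)).
  by rewrite !coefpsD !coefpsX0 coefpsM0 f0 g0 !expr1n mulr1.
have /eqP := fg; rewrite -subr_eq0 => /eqP <-.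
by ring.
Qed.

Lemma ps_dvd (f g : pseries int) : f 0%N = 1 -> exists h, f * h = g.
Proof. by move=> f0; exists (g * ps_inv f); rewrite mulrCA ps_mulfV ?mulr1. Qed.

Lemma ps_factor0 (f h : pseries int) : f 0%N = 1 -> (f * h) 0%N = 1 -> h 0%N = 1.
Proof. by move=> f0; rewrite coefpsM0 f0 mul1r. Qed.

(** Put E = E_25 (x - q - q^2 x'), E_2 = E_50 (y - q^2 - q^4 y') and
    psi = psi(q^25) (P0 + q P1 + q^3), the pieces being taken at q^5.  Residue 4
    of E psi = E_2^2 says y y' = 1, whence x x' = 1; residues 0 and 3 give P0
    and P1 in terms of x, y and k = q x' y'^2; residue 1 then becomes
    x^2 - y = k (x^2 + y), Ramanujan's relation between R(q) and R(q^2).  This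
    is solved by x = z (1 + k).  The second equation is the formula for E_2
    multiplied by y, which clears y'. *)
Lemma level10_parameters : exists P0 P1 y z k : pseries int,
  [/\ psi = dil 25 psi * build5 P0 P1 0 1 0,
      dil 2 eul * dil 5 y = dil 50 eul * build5 (y ^+ 2) 0 (- y) 0 (- 1),
      k 0%N = 0 /\ z 0%N = 1
    & [/\ P0 = z ^+ 3 * (1 + k) ^+ 2 * (1 - k) ^+ 2,
          P1 = z ^+ 2 * (1 + k) ^+ 2 * (1 - k),
          y = z ^+ 2 * (1 + k) * (1 - k)
        & psq = k * z ^+ 5 * (1 + k) ^+ 3 * (1 - k) ^+ 2]].
Proof.
set c := dil 5 eul; set c2 := dil 10 eul.
have c0 : c 0%N = 1 by rewrite dil_coef0 eul0.
have c20 : c2 0%N = 1 by rewrite dil_coef0 eul0.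
have [x cx] := ps_dvd (sect 5 0 eul) c0.
have [x' cx'] := ps_dvd (- sect 5 2 eul) c0.
have x0 : x 0%N = 1 by apply: (ps_factor0 c0); rewrite cx; apply: eul0.
have def_eul : eul = build5 (c * x) (- c) (- (c * x')) 0 0.
  by rewrite {1}[eul]build5E sect5_eul1 sect5_eul3 sect5_eul4 cx cx' opprK.
pose y := dil 2 x; pose y' := dil 2 x'.
have def_eul2 : dil 2 eul = build5 (c2 * y) 0 (- c2) 0 (- (c2 * y')).
  have c10 : dil 5 (dil 5 (dil 2 eul)) = dil 5 c2 by rewrite !dil_dil.
  have dil25C (f : pseries int) : dil 2 (dil 5 f) = dil 5 (dil 2 f).
    by rewrite !dil_dil.
  rewrite {1}def_eul /build5 /y /y' !(rmorphD, rmorphM, rmorphN, rmorphXn, rmorph0) /=.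
  by rewrite !dil_psq // !dil25C c10; ring.
pose C := dil 5 psi.
have C0 : C 0%N = 1 by rewrite dil_coef0 psi0.
have [P0 CP0] := ps_dvd (sect 5 0 psi) C0.
have [P1 CP1] := ps_dvd (sect 5 1 psi) C0.
have def_psi : psi = build5 (C * P0) (C * P1) 0 C 0.
  by rewrite {1}[psi]build5E sect5_psi2 sect5_psi3 sect5_psi4 CP0 CP1.
have cC : c * C = c2 ^+ 2 by rewrite -rmorphM eul_psi rmorphXn /= dil_dil.
have c2sq0 : (c2 ^+ 2) 0%N = 1 by rewrite coefpsX0 c20 expr1n.
have conv := eul_psi; rewrite expr2 {1}def_eul def_psi def_eul2 in conv.
have eq4 : y * y' = 1.
  apply: (@ps_cancel (c2 ^+ 2)) => //; apply: (@ps_natI 2) => //.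
  have := congr1 (sect 5 4) conv; rewrite !sect5M !sect5_build => eq4.
  apply/eqP; rewrite -subr_eq0; apply/eqP.
  transitivity (2%:R * (c2 * y) * (c2 * y') - (c2 * c2 + c * C)).
    by rewrite cC; ring.
  apply/eqP; rewrite subr_eq0; apply/eqP.
  apply: (addIr (- (c * C) - 2%:R * (c2 * y) * (c2 * y'))).
  transitivity (- (c * C)); first by ring.
  transitivity (c * x * 0 + - c * C + - (c * x') * 0 + 0 * (C * P1)
    + 0 * (C * P0)); first by ring.
  by rewrite eq4; ring.
have eq4' : x * x' = 1.
  by apply: (@dil_inj _ 2) => //; rewrite rmorphM rmorph1.
have eq0 : x * P0 - psq * x' = y ^+ 2.
  apply: (@ps_cancel (c2 ^+ 2)) => //.
  have := congr1 (sect 5 0) conv; rewrite !sect5M !sect5_build => eq0.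
  rewrite -{1}cC; transitivity (c * x * (C * P0)
    + psq * (- c * 0 + - (c * x') * C + 0 * 0 + 0 * (C * P1))).
    by ring.
  by rewrite eq0; ring.
have eq1 : x * P1 - P0 = 2%:R * psq * y'.
  apply: (@ps_cancel (c2 ^+ 2)) => //.
  have := congr1 (sect 5 1) conv; rewrite !sect5M !sect5_build => eq1.
  rewrite -{1}cC; transitivity (c * x * (C * P1) + - c * (C * P0)
    + psq * (- (c * x') * 0 + 0 * C + 0 * 0)).
    by ring.
  by rewrite eq1; ring.
have eq3 : x - x' * P1 = psq * y' ^+ 2.
  apply: (@ps_cancel (c2 ^+ 2)) => //.
  have := congr1 (sect 5 3) conv; rewrite !sect5M !sect5_build => eq3.
  rewrite -{1}cC; transitivity (c * x * C + - c * 0 + - (c * x') * (C * P1)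
    + 0 * (C * P0) + psq * (0 * 0)).
    by ring.
  by rewrite eq3; ring.
have y0 : y 0%N = 1 by rewrite dil_coef0.
pose k := psq * x' * y' ^+ 2.
have k0 : k 0%N = 0 by rewrite /k !coefpsM0 /= !mul0r.
pose u := 1 + k; have u0 : u 0%N = 1 by rewrite coefpsD k0 addr0.
have [z uz] := ps_dvd x u0.
have z0 : z 0%N = 1 by apply: (ps_factor0 u0); rewrite uz.
have def_q : psq = k * x * y ^+ 2.
  by transitivity (psq * (x * x') * (y * y') ^+ 2);
    [rewrite eq4 eq4'; ring | rewrite /k; ring].
have def_P1 : P1 = x ^+ 2 * (1 - k).
  transitivity (x ^+ 2 - x * (x - x' * P1) + (1 - x * x') * P1); first by ring.
  rewrite eq3 eq4'; transitivity (x ^+ 2 - x * x' * (x * psq * y' ^+ 2)).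
    by rewrite eq4'; ring.
  by rewrite /k; ring.
have def_xP0 : x * P0 = y ^+ 2 * u.
  transitivity ((x * P0 - psq * x') + psq * x'); first by ring.
  rewrite eq0 /u /k; transitivity (y ^+ 2 + (y * y') ^+ 2 * (psq * x')); last by ring.
  by rewrite eq4; ring.
have kxy : k * x ^+ 2 * y = psq * x * y'.
  by transitivity (psq * x * y' * (x * x') * (y * y'));
    [rewrite /k; ring | rewrite eq4 eq4'; ring].
(* Residue 1 times x; the factor x^2 + y has constant term 2. *)
have quad : (x ^+ 2 + y) * (x ^+ 2 - y) = (x ^+ 2 + y) * (k * (x ^+ 2 + y)).
  apply/eqP; rewrite -subr_eq0; apply/eqP.
  transitivity (x * (x * (x ^+ 2 * (1 - k))) - y ^+ 2 * u - 2%:R * (k * x ^+ 2 * y)).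
    by rewrite /u; ring.
  rewrite -def_P1 -def_xP0 kxy.
  by transitivity (x * (x * P1 - P0 - 2%:R * psq * y')); [ring | rewrite eq1; ring].
have lin : x ^+ 2 - y = k * (x ^+ 2 + y).
  apply: ps_mulfI quad; by rewrite coefpsD coefpsX0 x0 y0.
have def_y : y = z ^+ 2 * u * (1 - k).
  apply: (ps_cancel u0); transitivity ((u * z) ^+ 2 * (1 - k)); last by ring.
  rewrite uz; transitivity (y + k * (x ^+ 2 + y) - k * x ^+ 2); first by rewrite /u; ring.
  by rewrite -lin; ring.
have C25 : dil 5 C = dil 25 psi by rewrite dil_dil.
have c50 : dil 5 c2 = dil 50 eul by rewrite dil_dil.
exists P0, P1, y, z, k; split=> //.
- rewrite {1}def_psi /build5 (rmorphM (dil 5) C P0) (rmorphM (dil 5) C P1).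
  rewrite rmorph1 rmorph0 /= C25.
  by ring.
- rewrite def_eul2 -c50 /build5.
  rewrite !(rmorphN, rmorphM, rmorphXn, rmorph0, rmorph1) /=.
  transitivity (dil 5 c2 * (dil 5 y ^+ 2 - psq ^+ 2 * dil 5 y
    - psq ^+ 4 * (dil 5 y * dil 5 y'))); first by ring.
  by rewrite -rmorphM eq4 rmorph1; ring.
- split=> //.
  + apply: (ps_cancel x0); rewrite def_xP0 def_y -uz; rewrite -/u; ring.
  + by rewrite def_P1 -uz -/u; ring.
  + by rewrite {1}def_q {1}def_y -uz -/u; ring.
Qed.

(** * Powers of the dissected series *)

Section Theta.
Variable R : comNzRingType.
Implicit Types a b y : pseries R.

Lemma theta_cube a b : build5 a b 0 1 0 ^+ 3 =
  build5 (a ^+ 3 + 3%:R * psq * b ^+ 2) (3%:R * (a ^+ 2 * b + psq * a))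
    (3%:R * (a * b ^+ 2 + psq * b)) (b ^+ 3 + 3%:R * a ^+ 2) (6%:R * a * b + psq).
Proof.
rewrite /build5 !(rmorphD, rmorphM, rmorphXn, rmorph_nat, rmorph0, rmorph1) /=.
by rewrite !dil_psq //; ring.
Qed.

Lemma eta_pow5 y : build5 (y ^+ 2) 0 (- y) 0 (- 1) ^+ 5 =
  build5 (y ^+ 10 - 11%:R * psq ^+ 2 * y ^+ 5 - psq ^+ 4)
    (10%:R * psq * y ^+ 7 - 5%:R * psq ^+ 3 * y ^+ 2)
    (15%:R * psq ^+ 2 * y ^+ 4 - 5%:R * y ^+ 9)
    (- 15%:R * psq * y ^+ 6 - 5%:R * psq ^+ 3 * y)
    (5%:R * y ^+ 8 + 10%:R * psq ^+ 2 * y ^+ 3).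
Proof.
rewrite /build5 !(rmorphD, rmorphN, rmorphM, rmorphXn, rmorph_nat, rmorph0, rmorph1) /=.
by rewrite !dil_psq //; ring.
Qed.

Lemma eta_pow5_mod y : exists h, build5 (y ^+ 2) 0 (- y) 0 (- 1) ^+ 5 =
  dil 5 (y ^+ 10 - 11%:R * psq ^+ 2 * y ^+ 5 - psq ^+ 4) + 5%:R * h.
Proof.
exists (build5 0 (2%:R * psq * y ^+ 7 - psq ^+ 3 * y ^+ 2)
  (3%:R * psq ^+ 2 * y ^+ 4 - y ^+ 9) (- 3%:R * psq * y ^+ 6 - psq ^+ 3 * y)
  (y ^+ 8 + 2%:R * psq ^+ 2 * y ^+ 3)).
rewrite eta_pow5 /build5 rmorph0.
have dil_nat5 g : 5%:R * dil 5 g = dil 5 (5%:R * g) by rewrite rmorphM rmorph_nat.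
rewrite !mulrDr mulr0 add0r !(mulrCA 5%:R) !dil_nat5 !addrA.
by congr (_ + _ * dil 5 _ + _ * dil 5 _ + _ * dil 5 _ + _ * dil 5 _); ring.
Qed.

Lemma theta_pow5_mod a b : exists h, build5 a b 0 1 0 ^+ 5 =
  dil 5 (a ^+ 5 + psq * b ^+ 5 + psq ^+ 3) + 5%:R * h.
Proof.
pose A := dil 5 a; pose B := psq * dil 5 b; pose C : pseries R := psq ^+ 3.
exists (A ^+ 4 * B + 2%:R * A ^+ 3 * B ^+ 2 + 2%:R * A ^+ 2 * B ^+ 3 + A * B ^+ 4
  + (A + B) ^+ 4 * C + 2%:R * (A + B) ^+ 3 * C ^+ 2
  + 2%:R * (A + B) ^+ 2 * C ^+ 3 + (A + B) * C ^+ 4).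
rewrite /build5 rmorph0 rmorph1 !(rmorphD, rmorphM, rmorphXn) /= dil_psq //.
by rewrite /A /B /C; ring.
Qed.

(** For the higher powers of theta the only sections needed are symmetric
    enough to depend on a b, a^5 + q b^5 and q alone. *)
Lemma theta_pow4_sect2 a b : sect 5 2 (build5 a b 0 1 0 ^+ 4)
  = 6%:R * (a * b) ^+ 2 + 12%:R * psq * (a * b) + psq ^+ 2.
Proof. by rewrite exprSr theta_cube !sect5M !sect5_build; ring. Qed.

Lemma theta_pow4 a b : build5 a b 0 1 0 ^+ 4 =
  build5 (a ^+ 4 + 12%:R * psq * a * b ^+ 2 + 4%:R * psq ^+ 2 * b)
    (4%:R * a ^+ 3 * b + 6%:R * psq * a ^+ 2 + 4%:R * psq * b ^+ 3)
    (6%:R * (a * b) ^+ 2 + 12%:R * psq * (a * b) + psq ^+ 2)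
    (4%:R * a * b ^+ 3 + 4%:R * a ^+ 3 + 6%:R * psq * b ^+ 2)
    (b ^+ 4 + 12%:R * a ^+ 2 * b + 4%:R * psq * a).
Proof.
rewrite /build5 !(rmorphD, rmorphM, rmorphXn, rmorph_nat, rmorph0, rmorph1) /=.
by rewrite !dil_psq //; ring.
Qed.

Lemma theta_pow6_sect3 a b : sect 5 3 (build5 a b 0 1 0 ^+ 6)
  = 6%:R * (a ^+ 5 + psq * b ^+ 5 + psq ^+ 3) + 20%:R * (a * b) ^+ 3
    + 90%:R * psq * (a * b) ^+ 2 + 30%:R * psq ^+ 2 * (a * b) - 5%:R * psq ^+ 3.
Proof.
rewrite (_ : 6 = 3 + 3)%N // exprD theta_cube !sect5M !sect5_build.
ring.
Qed.

Lemma theta_pow8_sect4 a b : sect 5 4 (build5 a b 0 1 0 ^+ 8)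
  = 56%:R * (a * b + psq) * (a ^+ 5 + psq * b ^+ 5 + psq ^+ 3)
    + 70%:R * (a * b) ^+ 4 + 560%:R * psq * (a * b) ^+ 3
    + 420%:R * psq ^+ 2 * (a * b) ^+ 2 - 55%:R * psq ^+ 4.
Proof.
rewrite (_ : 8 = 4 + 4)%N // exprD theta_pow4 !sect5M !sect5_build.
ring.
Qed.

End Theta.

(** * Polynomial identities in the parameters *)

Section Genus0.
Variables (R : comNzRingType) (z k : R).
Let a := z ^+ 3 * (1 + k) ^+ 2 * (1 - k) ^+ 2.
Let b := z ^+ 2 * (1 + k) ^+ 2 * (1 - k).
Let y := z ^+ 2 * (1 + k) * (1 - k).
Let q := k * z ^+ 5 * (1 + k) ^+ 3 * (1 - k) ^+ 2.

(** The left-hand side is the norm of a + q b + q^3, by [ps_norm_theta]. *)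
Lemma genus0_psi :
  a ^+ 5 + q * b ^+ 5 + q ^+ 3 + 5%:R * (q * (a * b) ^+ 2 - q ^+ 2 * (a * b))
  = (a * b + q) ^+ 3.
Proof. by rewrite /a /b /q; ring. Qed.

Lemma genus0_eta :
  (y ^+ 10 - 11%:R * q ^+ 2 * y ^+ 5 - q ^+ 4) * (a * b)
  = y ^+ 5 * (a * b - 4%:R * q) * (a * b + q) ^+ 2.
Proof. by rewrite /a /b /q /y; ring. Qed.

(** The first factor on the left is 2 N theta_4 - (theta^3 eta^5)_4, where
    theta_4 is section 4 of theta^3, eta is the dissected series of E_2, and N
    is section 0 of eta^5; the sections are those of [theta_cube] and
    [eta_pow5]. *)
Lemma genus0_first :
  (2%:R * (y ^+ 10 - 11%:R * q ^+ 2 * y ^+ 5 - q ^+ 4) * (6%:R * a * b + q)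
   - ((a ^+ 3 + 3%:R * q * b ^+ 2) * (5%:R * y ^+ 8 + 10%:R * q ^+ 2 * y ^+ 3)
    + 3%:R * (a ^+ 2 * b + q * a) * (- 15%:R * q * y ^+ 6 - 5%:R * q ^+ 3 * y)
    + 3%:R * (a * b ^+ 2 + q * b) * (15%:R * q ^+ 2 * y ^+ 4 - 5%:R * y ^+ 9)
    + (b ^+ 3 + 3%:R * a ^+ 2) * (10%:R * q * y ^+ 7 - 5%:R * q ^+ 3 * y ^+ 2)
    + (6%:R * a * b + q) * (y ^+ 10 - 11%:R * q ^+ 2 * y ^+ 5 - q ^+ 4))) * (a * b)
  = y ^+ 5 * (16%:R * (a * b) ^+ 4 - 6%:R * q * (a * b) ^+ 3
     - 64%:R * q ^+ 2 * (a * b) ^+ 2 - 171%:R * q ^+ 3 * (a * b)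
     - 4%:R * q ^+ 4).
Proof. by rewrite /a /b /q /y; ring. Qed.

End Genus0.

(** * Congruences between integer series *)

Definition eqmod (m : nat) (f g : pseries int) :=
  exists h, f = g + m%:R * h.

Section Eqmod.
Variable m : nat.
Implicit Types f g h : pseries int.

Lemma eqmod_eq f g : f = g -> eqmod m f g.
Proof. by move=> ->; exists 0; rewrite mulr0 addr0. Qed.
Lemma eqmod_sym f g : eqmod m f g -> eqmod m g f.
Proof. by case=> h ->; exists (- h); ring. Qed.
Lemma eqmod_trans g f h : eqmod m f g -> eqmod m g h -> eqmod m f h.
Proof. by case=> u -> [v ->]; exists (u + v); ring. Qed.
Lemma eqmodD f f' g g' :
  eqmod m f f' -> eqmod m g g' -> eqmod m (f + g) (f' + g').
Proof. by case=> u -> [v ->]; exists (u + v); ring. Qed.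
Lemma eqmodM f f' g g' :
  eqmod m f f' -> eqmod m g g' -> eqmod m (f * g) (f' * g').
Proof.
by case=> u -> [v ->]; exists (u * g' + f' * v + m%:R * u * v); ring.
Qed.
Lemma eqmodMl h f g : eqmod m f g -> eqmod m (h * f) (h * g).
Proof. by case=> u ->; exists (h * u); ring. Qed.
Lemma eqmodX f g n : eqmod m f g -> eqmod m (f ^+ n) (g ^+ n).
Proof.
move=> fg; elim: n => [|n IH]; first exact: eqmod_eq.
by rewrite !exprS; apply: eqmodM.
Qed.
Lemma eqmod_sect d r f g : eqmod m f g -> eqmod m (sect d r f) (sect d r g).
Proof. by case=> u ->; exists (sect d r u); rewrite sectD sect_natl. Qed.
Lemma eqmod_cancel h f g : h 0%N = 1 -> eqmod m (h * f) (h * g) -> eqmod m f g.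
Proof.
move=> h0 /(eqmodMl (ps_inv h)).
by rewrite !mulrA [ps_inv h * h]mulrC ps_mulfV // !mul1r.
Qed.

Lemma eqmodP f g : eqmod m f g <-> forall n, (m%:Z %| f n - g n)%Z.
Proof.
split=> [[h ->] n|mfg].
  by rewrite coefpsD coefps_natl addrC addKr pmulrn intz dvdz_mulr.
exists (PSeries (fun n => (f n - g n) %/ m%:Z)%Z); apply/pseriesP => n.
by rewrite coefpsD coefps_natl /= pmulrn intz mulrC divzK // addrC subrK.
Qed.

End Eqmod.

Lemma eqmod_scale m n f g : eqmod n f g -> eqmod (m * n) (m%:R * f) (m%:R * g).
Proof. by case=> u ->; exists u; rewrite natrM; ring. Qed.

Lemma eqmod_descale m n f g : (0 < m)%N ->
  eqmod (m * n) (m%:R * f) (m%:R * g) -> eqmod n f g.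
Proof.
move=> m_gt0 [u e]; exists u; apply: (@ps_natI m) => //.
by rewrite e natrM; ring.
Qed.

Lemma fermat5 (a : int) : (5 %| a ^+ 5 - a)%Z.
Proof.
rewrite {2}(divz_eq a 5) {1}(divz_eq a 5); set c := (a %/ 5)%Z.
have: (0 <= a %% 5)%Z && (a %% 5 < 5)%Z by rewrite modz_ge0 ?ltz_mod.
case: (a %% 5)%Z => // r /andP[_ ltr5].
have [s e] : exists s : int, Posz r ^+ 5 - Posz r = 5 * s.
  case: r ltr5 => [|[|[|[|[|r]]]]] // _.
  - by exists 0.
  - by exists 0.
  - by exists 6.
  - by exists 48.
  - by exists 204.
move: (Posz r) e => r' e; apply/dvdzP.
exists (625%:R * c ^+ 5 + 625%:R * c ^+ 4 * r' + 250%:R * c ^+ 3 * r' ^+ 2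
  + 50%:R * c ^+ 2 * r' ^+ 3 + 5%:R * c * r' ^+ 4 + s - c).
transitivity (3125%:R * c ^+ 5 + 3125%:R * c ^+ 4 * r' + 1250%:R * c ^+ 3 * r' ^+ 2
  + 250%:R * c ^+ 2 * r' ^+ 3 + 25%:R * c * r' ^+ 4 - 5%:R * c + (r' ^+ 5 - r')).
  by ring.
by rewrite e; ring.
Qed.

Lemma eqmod5D (f g : pseries int) : eqmod 5 ((f + g) ^+ 5) (f ^+ 5 + g ^+ 5).
Proof.
exists (f ^+ 4 * g + 2%:R * f ^+ 3 * g ^+ 2 + 2%:R * f ^+ 2 * g ^+ 3 + f * g ^+ 4).
by ring.
Qed.

(** By induction on the truncations of f: modulo 5 the fifth power is additive
    and fixes the integers. *)
Lemma eqmod_frobenius (f : pseries int) : eqmod 5 (f ^+ 5) (dil 5 f).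
Proof.
pose F N := \sum_(i < N) psC (f i) * psq ^+ i.
have agF N : agree N f (F N).
  move=> n ltnN; rewrite coefps_sum (bigD1 (Ordinal ltnN)) //.
  rewrite coef_psCM coef_psqXn eqxx mulr1 big1 => [|i]; first by rewrite /= addr0.
  rewrite -val_eqE coef_psCM coef_psqXn eq_sym => /negPf /= ->.
  by rewrite mulr0.
have frobF N : eqmod 5 (F N ^+ 5) (dil 5 (F N)).
  elim: N => [|N IH]; first by rewrite /F big_ord0 rmorph0 expr0n; apply: eqmod_eq.
  rewrite /F big_ord_recr /= -/(F N) rmorphD; apply: eqmod_trans (eqmod5D _ _) _.
  apply: eqmodD => //; rewrite exprMn rmorphM rmorphXn /= dil_psq // -exprM mulnC exprM.
  rewrite mulrC [X in eqmod _ _ X]mulrC; apply: eqmodMl; apply/eqmodP => n.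
  rewrite -rmorphXn coef_dil /=; case: n => [|n]; first by rewrite fermat5.
  case: ifP => [/dvdnP[[|c] def_n]|_]; rewrite ?subrr ?dvdz0 //.
  by rewrite def_n mulnK //= subrr dvdz0.
apply/eqmodP => n; have agn := agF n.+1.
rewrite (agreeX 5 agn (ltnSn n)) (agree_dil (isT : 0 < 5)%N agn (ltnSn n)).
exact: (proj1 (eqmodP _ _ _) (frobF n.+1)).
Qed.

(** * Three successive sections *)

Lemma fifth_root_exists : exists c : algC,
  1 + c + c ^+ 2 + c ^+ 3 + c ^+ 4 = 0.
Proof.
have [w w_prim] := C_prim_root_exists (isT : 0 < 5)%N; exists w.
have w5 := prim_expr_order w_prim.
have w1 : w - 1 != 0.
  rewrite subr_eq0; apply/eqP => w1.
  by have := prim_order_dvd w_prim 1; rewrite w1 expr1n eqxx.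
apply: (mulfI w1); rewrite mulr0; transitivity (w ^+ 5 - 1); first by ring.
by rewrite w5 subrr.
Qed.

(** The variables stand for the series of [level10_parameters]. *)
Section Level10.
Variables (P0 P1 y z k : pseries int).
Hypothesis thetaE : psi = dil 25 psi * build5 P0 P1 0 1 0.
Hypothesis etaE : dil 2 eul * dil 5 y = dil 50 eul * build5 (y ^+ 2) 0 (- y) 0 (- 1).
Hypotheses (k0 : k 0%N = 0) (z0 : z 0%N = 1).
Hypothesis defP0 : P0 = z ^+ 3 * (1 + k) ^+ 2 * (1 - k) ^+ 2.
Hypothesis defP1 : P1 = z ^+ 2 * (1 + k) ^+ 2 * (1 - k).
Hypothesis defy : y = z ^+ 2 * (1 + k) * (1 - k).
Hypothesis defq : psq = k * z ^+ 5 * (1 + k) ^+ 3 * (1 - k) ^+ 2.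

Local Notation J := (P0 * P1).
Local Notation V := (P0 * P1 + psq).

Let psi5_0 : dil 5 psi 0%N = 1. Proof. by rewrite dil_coef0 psi0. Qed.
Let P0_0 : P0 0%N = 1.
Proof. by rewrite defP0 !coefpsM0 !coefpsD !coefpsN k0 z0 coefps1. Qed.
Let P1_0 : P1 0%N = 1.
Proof. by rewrite defP1 !coefpsM0 !coefpsD !coefpsN k0 z0 coefps1. Qed.
Let J0 : J 0%N = 1. Proof. by rewrite coefpsM0 P0_0 P1_0. Qed.
Let V0 : V 0%N = 1. Proof. by rewrite coefpsD J0 addr0. Qed.
Let y0 : y 0%N = 1.
Proof.
rewrite defy !coefpsM0 ?coefpsX0 !coefpsD !coefpsN k0 z0 coefps1.
by [].
Qed.

Local Notation e := (map_ps (intr : {rmorphism int -> algC})).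

(** Both sides, taken at q^5, are the norm of psi times psi(q^25): the right
    one by expanding the norm of theta, the left one by [ps_norm_psi]. *)
Lemma psi_pow6 : psi ^+ 6 = dil 5 psi ^+ 6
  * (P0 ^+ 5 + psq * P1 ^+ 5 + psq ^+ 3
     + 5%:R * (psq * P0 ^+ 2 * P1 ^+ 2 - psq ^+ 2 * P0 * P1)).
Proof.
have [c cyc] := fifth_root_exists.
have norm_psi := ps_norm_psi cyc.
have e_inj : injective e by apply/map_ps_inj/intr_inj.
apply: (@dil_inj _ 5) => //; apply: e_inj.
have theta_e : e psi = dil 25 (e psi)
    * (dil 5 (e P0) + psq * dil 5 (e P1) + psq ^+ 3 * dil 5 1).
  rewrite {1}thetaE rmorphM /= map_ps_dil; congr (_ * _).
  rewrite /build5 !(rmorphD, rmorphM, rmorphXn, rmorph0, rmorph1) /=.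
  by rewrite !map_psq !map_ps_dil; ring.
have norm_dil25 : ps_norm c (dil 25 (e psi)) = dil 25 (e psi) ^+ 5.
  rewrite /ps_norm (eq_bigr (fun=> dil 25 (e psi))) ?prodr_const ?card_ord // => j _.
  rewrite twist_dil //; have -> : (c ^+ j) ^+ 25 = 1.
    by rewrite exprAC (exprM c 5 5) !(fifth_root1 cyc, expr1n).
  by rewrite twist1.
have := norm_psi; rewrite [X in ps_norm c X]theta_e ps_normM norm_dil25.
rewrite (ps_norm_theta cyc).
rewrite (_ : dil 5 (e psi) ^+ 6 = e (dil 5 (psi ^+ 6))); last first.
  by rewrite map_ps_dil rmorphXn /= -map_ps_dil rmorphXn /= map_ps_dil.
move=> <-; have dil25 : dil 25 (e psi) = e (dil 5 (dil 5 psi)).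
  by rewrite dil_dil // map_ps_dil.
set N := (X in dil 5 psi ^+ 6 * X).
set Ne := (X in dil 25 _ ^+ 5 * dil 5 X).
have -> : Ne = e N.
  rewrite /Ne /N !(rmorphD, rmorphN, rmorphM, rmorphXn, rmorph_nat) /= !map_psq.
  by rewrite !expr1n !mulr1.
rewrite dil25 -map_ps_dil; transitivity (e (dil 5 (dil 5 psi)) ^+ 6 * e (dil 5 N)).
  by ring.
by rewrite -!(rmorphXn e) -(rmorphM e) -(rmorphXn (dil 5)) -(rmorphM (dil 5)).
Qed.

Lemma psi_square : psi ^+ 2 = dil 5 psi ^+ 2 * V.
Proof.
apply: ps_cube_inj; [by rewrite coefpsX0 psi0| |].
  by rewrite coefpsM0 coefpsX0 psi5_0 V0.
have cubic := genus0_psi z k; rewrite -defP0 -defP1 -defq in cubic.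
rewrite -exprM psi_pow6 exprMn -exprM -cubic; congr (_ * _).
by ring.
Qed.

Local Notation theta := (build5 P0 P1 0 1 0).
Local Notation M := (P0 ^+ 5 + psq * P1 ^+ 5 + psq ^+ 3).

Let M_cubic : M = J ^+ 3 - 2%:R * psq * J ^+ 2 + 8%:R * psq ^+ 2 * J + psq ^+ 3.
Proof.
have cubic := genus0_psi z k; rewrite -defP0 -defP1 -defq in cubic.
apply: (addIr (5%:R * (psq * J ^+ 2 - psq ^+ 2 * J))); rewrite cubic.
by ring.
Qed.

Let M0 : M 0%N = 1.
Proof. by rewrite !coefpsD !coefpsM0 P0_0 P1_0. Qed.

Variable f : pseries int.
Hypothesis defF : f * dil 2 eul ^+ 5 = psi ^+ 3.

Let eul_dil0 d : dil d eul 0%N = 1. Proof. by rewrite dil_coef0 eul0. Qed.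

(** E_2^5 is E_50^5 eta^5 up to the fifth power of y, and eta^5 = N + 5h with N
    in q^5.  Multiplying F E_2^5 = psi^3 by 2N - eta^5 leaves N^2 on the left
    modulo 25, so that section 4 can be taken. *)
Lemma first_sect_raw :
  let N := y ^+ 10 - 11%:R * psq ^+ 2 * y ^+ 5 - psq ^+ 4 in
  eqmod 25 (sect 5 4 f * dil 10 eul ^+ 5 * N ^+ 2)
    (dil 5 psi ^+ 3 * y ^+ 5 * (2%:R * N * sect 5 4 (theta ^+ 3)
       - sect 5 4 (theta ^+ 3 * build5 (y ^+ 2) 0 (- y) 0 (- 1) ^+ 5))).
Proof.
move=> N; set eta := build5 (y ^+ 2) _ _ _ _.
have [h eta5] : exists h, eta ^+ 5 = dil 5 N + 5%:R * h by exact: eta_pow5_mod.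
have f_eta : f * dil 50 eul ^+ 5 * eta ^+ 5 = dil 25 psi ^+ 3 * dil 5 y ^+ 5 * theta ^+ 3.
  rewrite -mulrA -exprMn -etaE exprMn mulrA defF [in LHS]thetaE.
  by ring.
have e50 : dil 50 eul = dil 5 (dil 10 eul) by rewrite dil_dil.
have p25 : dil 25 psi = dil 5 (dil 5 psi) by rewrite dil_dil.
have lhs : sect 5 4 (f * dil 50 eul ^+ 5 * dil 5 N ^+ 2)
    = sect 5 4 f * dil 10 eul ^+ 5 * N ^+ 2.
  rewrite e50 -mulrA mulrC -(rmorphXn (dil 5)) -(rmorphXn (dil 5)).
  by rewrite -(rmorphM (dil 5)) sect_dilM //; ring.
have rhs : sect 5 4 (dil 25 psi ^+ 3 * dil 5 y ^+ 5
      * (2%:R * dil 5 N * theta ^+ 3 - theta ^+ 3 * eta ^+ 5))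
    = dil 5 psi ^+ 3 * y ^+ 5
      * (2%:R * N * sect 5 4 (theta ^+ 3) - sect 5 4 (theta ^+ 3 * eta ^+ 5)).
  rewrite p25 -!(rmorphXn (dil 5)) -(rmorphM (dil 5)) sect_dilM // sectB.
  by rewrite -[in LHS](mulrA 2%:R) sect_natl sect_dilM // mulrA.
rewrite -lhs -rhs; apply: eqmod_sect; exists (f * dil 50 eul ^+ 5 * h ^+ 2).
transitivity (f * dil 50 eul ^+ 5 * eta ^+ 5 * (2%:R * dil 5 N - eta ^+ 5)
  + 25%:R * (f * dil 50 eul ^+ 5 * h ^+ 2)).
  by rewrite eta5; ring.
by rewrite f_eta; ring.
Qed.

(** By [genus0_eta] and [genus0_first] both sides of [first_sect_raw], times
    (P0 P1)^2, are polynomials in q and P0 P1 up to common factors; the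
    witness is their difference divided by 25, and is homogeneous in q and
    P0 P1. *)
Lemma first_sect :
  eqmod 25 (sect 5 4 f * dil 10 eul ^+ 5 * V ^+ 3)
    (dil 5 psi ^+ 3 * (16%:R * V ^+ 2 + 24%:R * psq * V + 10%:R * psq ^+ 2)).
Proof.
apply: (@eqmod_cancel _ (y ^+ 10 * V * (V - 5%:R * psq) ^+ 2)).
  by rewrite !(coefpsM0, coefpsX0, coefpsD, coefpsN) P0_0 P1_0 y0.
have := first_sect_raw; cbv zeta; set N := _ - psq ^+ 4.
set K := _ - sect 5 4 (_ * _) => raw.
have NJ : N * J = y ^+ 5 * (V - 5%:R * psq) * V ^+ 2.
  have := genus0_eta z k; rewrite -defP0 -defP1 -defq -defy => e.
  by rewrite /N e; ring.
have KJ : K * J = y ^+ 5 * (16%:R * J ^+ 4 - 6%:R * psq * J ^+ 3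
   - 64%:R * psq ^+ 2 * J ^+ 2 - 171%:R * psq ^+ 3 * J - 4%:R * psq ^+ 4).
  have := genus0_first z k; rewrite -defP0 -defP1 -defq -defy => <-.
  by rewrite /K theta_cube eta_pow5 sect5M !sect5_build /N; ring.
have := eqmodMl (J ^+ 2) raw => {raw}.
have -> : J ^+ 2 * (sect 5 4 f * dil 10 eul ^+ 5 * N ^+ 2)
    = y ^+ 10 * V * (V - 5%:R * psq) ^+ 2
      * (sect 5 4 f * dil 10 eul ^+ 5 * V ^+ 3).
  transitivity (sect 5 4 f * dil 10 eul ^+ 5 * (N * J) ^+ 2); first by ring.
  by rewrite NJ; ring.
have -> : J ^+ 2 * (dil 5 psi ^+ 3 * y ^+ 5 * K)
    = dil 5 psi ^+ 3 * y ^+ 5 * J * (K * J) by ring.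
move=> raw; apply: eqmod_trans raw _; rewrite KJ.
exists (dil 5 psi ^+ 3 * y ^+ 10 * psq * (2%:R * J ^+ 4 + 6%:R * psq * J ^+ 3
  - 21%:R * psq ^+ 2 * J ^+ 2 - 52%:R * psq ^+ 3 * J - 32%:R * psq ^+ 4)).
by ring.
Qed.

(** The same device applied to theta^5, after V has been replaced by
    psi^2 / psi(q^5)^2 in [first_sect].  The term with psi^-1 carries the factor
    10, so that only theta^-1 = theta^4 / theta^5 modulo 5 is needed there. *)
Lemma second_sect :
  eqmod 25 (sect 5 4 (sect 5 4 f) * dil 2 eul ^+ 5 * dil 5 psi ^+ 2 * M ^+ 2)
    (10%:R * (psi ^+ 5 * J * V ^+ 3)).
Proof.
pose D := dil 25 psi; pose w := ps_inv psi.
have psi_w : psi * w = 1 by rewrite ps_mulfV ?psi0.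
have [g theta5] : exists g, theta ^+ 5 = dil 5 M + 5%:R * g.
  exact: theta_pow5_mod.
have first : eqmod 25 (sect 5 4 f * dil 10 eul ^+ 5 * psi ^+ 5)
    (dil 5 psi ^+ 5 * (16%:R * psi ^+ 3 + 24%:R * psq * psi * dil 5 psi ^+ 2
      + 10%:R * psq ^+ 2 * dil 5 psi ^+ 4 * w)).
  have := eqmodMl (dil 5 psi ^+ 6 * w) first_sect.
  have -> : dil 5 psi ^+ 6 * w * (sect 5 4 f * dil 10 eul ^+ 5 * V ^+ 3)
      = sect 5 4 f * dil 10 eul ^+ 5 * psi ^+ 5.
    transitivity (sect 5 4 f * dil 10 eul ^+ 5 * (dil 5 psi ^+ 2 * V) ^+ 3 * w).
      by ring.
    rewrite -psi_square; transitivity (sect 5 4 f * dil 10 eul ^+ 5 * psi ^+ 5 * (psi * w)).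
      by ring.
    by rewrite psi_w mulr1.
  have -> // : dil 5 psi ^+ 6 * w * (dil 5 psi ^+ 3
        * (16%:R * V ^+ 2 + 24%:R * psq * V + 10%:R * psq ^+ 2))
      = dil 5 psi ^+ 5 * (16%:R * psi ^+ 3 + 24%:R * psq * psi * dil 5 psi ^+ 2
      + 10%:R * psq ^+ 2 * dil 5 psi ^+ 4 * w).
  transitivity (dil 5 psi ^+ 5 * (16%:R * (dil 5 psi ^+ 2 * V) ^+ 2
     + 24%:R * psq * (dil 5 psi ^+ 2 * V) * dil 5 psi ^+ 2
     + 10%:R * psq ^+ 2 * dil 5 psi ^+ 4) * w); first by ring.
  rewrite -psi_square; transitivity (dil 5 psi ^+ 5 * (16%:R * psi ^+ 3 * (psi * w)
     + 24%:R * psq * psi * (psi * w) * dil 5 psi ^+ 2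
     + 10%:R * psq ^+ 2 * dil 5 psi ^+ 4 * w)); first by ring.
  by rewrite psi_w; ring.
have scaled := eqmodMl (D * (2%:R * dil 5 M - theta ^+ 5)) first.
pose S1 := sect 5 4 f.
have lhs : eqmod 25 (D * (2%:R * dil 5 M - theta ^+ 5) * (S1 * dil 10 eul ^+ 5 * psi ^+ 5))
    (S1 * dil 10 eul ^+ 5 * D ^+ 6 * dil 5 M ^+ 2).
  exists (- (S1 * dil 10 eul ^+ 5 * D ^+ 6 * g ^+ 2)).
  rewrite [in LHS]thetaE -/D exprMn theta5; ring.
have wD : w * D * theta = 1 by rewrite -mulrA -thetaE mulrC.
have tD : psi = D * theta := thetaE.
have DE : dil 5 (dil 5 psi) = D by rewrite dil_dil.
have dil2 u v : dil 5 (u * v) = dil 5 u * dil 5 v :> pseries int := rmorphM _ _ _.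
have dilX u n : dil 5 (u ^+ n) = dil 5 u ^+ n :> pseries int := rmorphXn _ _ _.
have dil_nat n : dil 5 n%:R = n%:R :> pseries int := rmorph_nat _ _.
have dil3 u v t : dil 5 (u * v * t) = dil 5 u * dil 5 v * dil 5 t :> pseries int.
  by rewrite !dil2.
have dil4 u v t s : dil 5 (u * v * t * s)
    = dil 5 u * dil 5 v * dil 5 t * dil 5 s :> pseries int by rewrite !dil2.
have rhs : eqmod 25 (D * (2%:R * dil 5 M - theta ^+ 5)
      * (dil 5 psi ^+ 5 * (16%:R * psi ^+ 3 + 24%:R * psq * psi * dil 5 psi ^+ 2
          + 10%:R * psq ^+ 2 * dil 5 psi ^+ 4 * w)))
    (dil 5 (psi ^+ 5 * 16%:R * dil 5 psi ^+ 4)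
       * (2%:R * (dil 5 M * theta ^+ 3) - theta ^+ 8)
     + dil 5 (psi ^+ 5 * 24%:R * dil 5 psi ^+ 2 * psi ^+ 2)
       * (psq * (2%:R * (dil 5 M * theta) - theta ^+ 6))
     + dil 5 (10%:R * psi ^+ 9) * (psq * (psq * theta ^+ 4))).
  exists (- 4%:R * psq ^+ 2 * dil 5 psi ^+ 9 * g * D * w).
  rewrite dil3 (dil4 (psi ^+ 5)) dil2 !dilX !dil_nat DE.
  transitivity (dil 5 psi ^+ 5 * (2%:R * dil 5 M - theta ^+ 5)
    * (16%:R * D * psi ^+ 3 + 24%:R * psq * D * psi * dil 5 psi ^+ 2)
    + 10%:R * psq ^+ 2 * dil 5 psi ^+ 9 * w * D * (2%:R * dil 5 M - theta ^+ 5)).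
    by ring.
  transitivity (dil 5 psi ^+ 5 * (2%:R * dil 5 M - theta ^+ 5)
    * (16%:R * D ^+ 4 * theta ^+ 3 + 24%:R * psq * D ^+ 2 * theta * dil 5 psi ^+ 2)
    + 10%:R * psq ^+ 2 * dil 5 psi ^+ 9 * (w * D * theta) * theta ^+ 4
    - 100%:R * psq ^+ 2 * dil 5 psi ^+ 9 * g * D * w).
    have -> : dil 5 M = theta ^+ 5 - 5%:R * g by rewrite theta5 addrK.
    by move: (dil 5 psi) => p5; rewrite tD; ring.
  by rewrite wD; ring.
have := eqmod_trans (eqmod_sym lhs) (eqmod_trans scaled rhs).
move/(eqmod_sect 5 4).
have -> : sect 5 4 (S1 * dil 10 eul ^+ 5 * D ^+ 6 * dil 5 M ^+ 2)
    = dil 5 psi ^+ 4 * (sect 5 4 S1 * dil 2 eul ^+ 5 * dil 5 psi ^+ 2 * M ^+ 2).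
  rewrite (_ : _ * _ = dil 5 (dil 2 eul ^+ 5 * dil 5 psi ^+ 6 * M ^+ 2) * S1).
    by rewrite sect_dilM //; ring.
  rewrite dil3 !dilX DE (_ : dil 5 (dil 2 eul) = dil 10 eul) ?dil_dil //.
  by ring.
rewrite !sectD !sect_dilM // !sect_psqM !sectB !sect_natl !sect_dilM //.
rewrite theta_pow8_sect4 theta_pow6_sect3 theta_pow4_sect2 theta_cube !sect5_build.
move=> sections; apply: (@eqmod_cancel _ (dil 5 psi ^+ 4)).
  by rewrite coefpsX0 psi5_0.
apply: eqmod_trans sections _.
exists (dil 5 psi ^+ 4 * psi ^+ 5 * (- 94%:R * J ^+ 4 - 430%:R * psq * J ^+ 3
  - 552%:R * psq ^+ 2 * J ^+ 2 - 358%:R * psq ^+ 3 * J + 2%:R * psq ^+ 4)).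
rewrite (_ : psi ^+ 9 = psi ^+ 5 * (psi ^+ 2) ^+ 2); last by ring.
by rewrite psi_square M_cubic; ring.
Qed.

Let M_mod5 : eqmod 5 M (V ^+ 3).
Proof.
exists (- (psq * J ^+ 2) + psq ^+ 2 * J); rewrite M_cubic; ring.
Qed.

(** Modulo 5 one has M = V^3 and f^5 = f(q^5), so after division by 5 all the
    powers of V in [second_sect] can be traded for powers of psi and
    psi(q^5). *)
Lemma second_sect_dvd : exists2 g, sect 5 4 (sect 5 4 f) = 5%:R * g &
  eqmod 5 (g * dil 10 eul)
    (2%:R * (psi * dil 5 psi ^+ 2 - psq * psi ^+ 4 * dil 5 psi ^+ 3)).
Proof.
pose u := dil 2 eul ^+ 5 * dil 5 psi ^+ 2 * M ^+ 2.
have u0 : u 0%N = 1 by rewrite /u !coefpsM0 ?coefpsX0 M0 psi5_0 eul_dil0.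
have [h0 S2u] := second_sect.
have [g S2] : exists g, sect 5 4 (sect 5 4 f) = 5%:R * g.
  exists (ps_inv u * (2%:R * (psi ^+ 5 * J * V ^+ 3) + 5%:R * h0)).
  apply: (ps_cancel u0); transitivity (10%:R * (psi ^+ 5 * J * V ^+ 3) + 25%:R * h0).
    by rewrite -S2u /u; ring.
  transitivity (u * ps_inv u * (10%:R * (psi ^+ 5 * J * V ^+ 3) + 25%:R * h0)).
    by rewrite ps_mulfV // mul1r.
  by ring.
exists g => //.
have step1 : eqmod 5 (g * u) (2%:R * (psi ^+ 5 * J * V ^+ 3)).
  apply: (@eqmod_descale 5) => //; exists h0.
  transitivity (10%:R * (psi ^+ 5 * J * V ^+ 3) + 25%:R * h0); last by ring.
  by rewrite -S2u S2 /u; ring.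
have frob_psi := eqmod_frobenius psi.
have frob_eul : eqmod 5 (dil 2 eul ^+ 5) (dil 10 eul).
  by have := eqmod_frobenius (dil 2 eul); rewrite dil_dil.
have V3_0 : (V ^+ 3) 0%N = 1 by rewrite coefpsX0 V0.
have step2 : eqmod 5 (g * dil 10 eul * dil 5 psi * V ^+ 3) (2%:R * J).
  apply: (@eqmod_cancel _ (dil 5 psi * V ^+ 3)); first by rewrite coefpsM0 psi5_0 V3_0.
  have -> : dil 5 psi * V ^+ 3 * (2%:R * J) = dil 5 psi * (2%:R * J * V ^+ 3) by ring.
  have : eqmod 5 (dil 5 psi * (2%:R * J * V ^+ 3)) (2%:R * (psi ^+ 5 * J * V ^+ 3)).
    have -> : 2%:R * (psi ^+ 5 * J * V ^+ 3) = psi ^+ 5 * (2%:R * J * V ^+ 3) by ring.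
    by apply: eqmodM (eqmod_sym frob_psi) (eqmod_eq _ _).
  move=> rhs; apply: eqmod_trans (eqmod_sym rhs).
  apply: eqmod_trans step1; apply: eqmod_sym.
  have -> : dil 5 psi * V ^+ 3 * (g * dil 10 eul * dil 5 psi * V ^+ 3)
      = g * (dil 10 eul * dil 5 psi ^+ 2 * (V ^+ 3) ^+ 2) by ring.
  apply: eqmodMl; apply: eqmodM; last exact: eqmodX M_mod5.
  by apply: eqmodM => //; apply: eqmod_eq.
have psi6 : eqmod 5 (psi ^+ 6) (psi * dil 5 psi).
  by rewrite exprS; apply: eqmodMl.
apply: (@eqmod_cancel _ (dil 5 psi)) => //.
have step3 : eqmod 5 (dil 5 psi ^+ 2 * psi * (g * dil 10 eul))
    (dil 5 psi ^+ 2 * (2%:R * (psi ^+ 2 * dil 5 psi ^+ 2 - psq * dil 5 psi ^+ 4))).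
  have := eqmodMl (dil 5 psi ^+ 6) step2.
  have -> : dil 5 psi ^+ 6 * (g * dil 10 eul * dil 5 psi * V ^+ 3)
      = g * dil 10 eul * dil 5 psi * psi ^+ 6.
    by rewrite (exprM psi 2 3) psi_square; ring.
  have -> : dil 5 psi ^+ 6 * (2%:R * J)
      = dil 5 psi ^+ 2 * (2%:R * (psi ^+ 2 * dil 5 psi ^+ 2 - psq * dil 5 psi ^+ 4)).
    by rewrite psi_square; ring.
  move=> e; apply: eqmod_trans e; apply: eqmod_sym.
  have := eqmodMl (g * dil 10 eul * dil 5 psi) psi6.
  by move/eqmod_trans; apply; apply: eqmod_eq; ring.
have psi5_2 : (dil 5 psi ^+ 2) 0%N = 1 by rewrite coefpsX0 psi5_0.
have step4 : eqmod 5 (psi * (g * dil 10 eul))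
    (2%:R * (psi ^+ 2 * dil 5 psi ^+ 2 - psq * dil 5 psi ^+ 4)).
  by apply: (eqmod_cancel psi5_2); rewrite mulrA.
have := eqmodMl (psi ^+ 4) step4.
rewrite mulrA -exprSr => step5.
apply: eqmod_trans (eqmodM (eqmod_sym frob_psi) (eqmod_eq _ (erefl _))) _.
apply: eqmod_trans step5 _.
have -> : psi ^+ 4 * (2%:R * (psi ^+ 2 * dil 5 psi ^+ 2 - psq * dil 5 psi ^+ 4))
  = psi ^+ 6 * (2%:R * dil 5 psi ^+ 2) + - 2%:R * psq * psi ^+ 4 * dil 5 psi ^+ 4.
  by ring.
have -> : dil 5 psi * (2%:R * (psi * dil 5 psi ^+ 2 - psq * psi ^+ 4 * dil 5 psi ^+ 3))
  = psi * dil 5 psi * (2%:R * dil 5 psi ^+ 2) + - 2%:R * psq * psi ^+ 4 * dil 5 psi ^+ 4.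
  by ring.
by apply: eqmodD; [apply: eqmodM => //|]; apply: eqmod_eq.
Qed.

(** Section 3 of psi is psi(q^5), and section 2 of psi^4 is
    psi(q^5)^4 V^2 = psi^4 modulo 5; the two terms then cancel, because psi^5 is
    psi(q^5) modulo 5. *)
Lemma third_sect : eqmod 25 (sect 5 3 (sect 5 4 (sect 5 4 f))) 0.
Proof.
have [g -> g_mod] := second_sect_dvd.
rewrite sect_natl -(mulr0 5%:R); apply: (@eqmod_scale 5 5).
apply: (@eqmod_cancel _ (dil 2 eul)) => //; rewrite mulr0.
have := eqmod_sect 5 3 g_mod.
have -> : sect 5 3 (g * dil 10 eul) = dil 2 eul * sect 5 3 g.
  have -> : dil 10 eul = dil 5 (dil 2 eul) by rewrite dil_dil.
  by rewrite mulrC sect_dilM.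
move/eqmod_trans; apply.
have -> : sect 5 3 (2%:R * (psi * dil 5 psi ^+ 2 - psq * psi ^+ 4 * dil 5 psi ^+ 3))
    = 2%:R * (psi ^+ 2 * dil 5 psi
        - psi ^+ 3 * (dil 5 psi ^+ 4 * sect 5 2 (theta ^+ 4))).
  have t1 : sect 5 3 (psi * dil 5 psi ^+ 2) = psi ^+ 2 * dil 5 psi.
    by rewrite -(rmorphXn (dil 5)) mulrC sect_dilM // sect5_psi3.
  have t2 : sect 5 3 (psq * psi ^+ 4 * dil 5 psi ^+ 3)
      = psi ^+ 3 * sect 5 2 (psi ^+ 4).
    by rewrite -(rmorphXn (dil 5)) mulrC sect_dilM // sect_psqM.
  rewrite sect_natl sectB t1 t2; congr (_ * (_ - _ * _)).
  have p25 : dil 25 psi = dil 5 (dil 5 psi) by rewrite dil_dil.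
  by rewrite {1}thetaE exprMn p25 -(rmorphXn (dil 5)) sect_dilM.
rewrite theta_pow4_sect2.
have -> : 6%:R * J ^+ 2 + 12%:R * psq * J + psq ^+ 2
    = V ^+ 2 + 5%:R * (J ^+ 2 + 2%:R * psq * J) by ring.
have [h frob_psi] := eqmod_frobenius psi.
exists (- 2%:R * h * psi ^+ 2 - 2%:R * psi ^+ 3 * dil 5 psi ^+ 4
  * (J ^+ 2 + 2%:R * psq * J)).
transitivity (2%:R * psi ^+ 2 * dil 5 psi - 2%:R * psi ^+ 3 * (dil 5 psi ^+ 2 * V) ^+ 2
  - 10%:R * psi ^+ 3 * dil 5 psi ^+ 4 * (J ^+ 2 + 2%:R * psq * J)); first by ring.
rewrite -psi_square.
transitivity (2%:R * psi ^+ 2 * dil 5 psi - 2%:R * psi ^+ 2 * psi ^+ 5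
  - 10%:R * psi ^+ 3 * dil 5 psi ^+ 4 * (J ^+ 2 + 2%:R * psq * J)); first by ring.
by rewrite frob_psi; ring.
Qed.

End Level10.

(** * Broken diamond partitions *)

Lemma pseries_fps_mul (f g : fps) :
  PSeries (fps_mul f g) = PSeries f * PSeries g.
Proof. by apply/pseriesP. Qed.

Lemma pseries_fps_exp (f : fps) m : PSeries (fps_exp f m) = PSeries f ^+ m.
Proof.
elim: m => [|m IH]; first exact/pseriesP.
by rewrite exprS -IH -pseries_fps_mul.
Qed.

Lemma Delta_series k : PSeries (Delta k)
    * (eul ^+ 3 * dil (2 * (2 * k + 1)) eul) = dil 2 eul * dil (2 * k + 1) eul.
Proof.
have Delta_eq : PSeries (fps_mul (Delta k) (fps_mul (fps_exp (qpoch 1 1) 3)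
      (qpoch (2 * (2 * k + 1)) (2 * (2 * k + 1)))))
    = PSeries (fps_mul (qpoch 2 2) (qpoch (2 * k + 1) (2 * k + 1))).
  by apply/pseriesP; apply: Delta_genfun.
have k1_gt0 : (0 < 2 * k + 1)%N by rewrite addn1.
rewrite (pseries_fps_mul (Delta k)) (pseries_fps_mul (fps_exp _ _)) in Delta_eq.
rewrite pseries_fps_exp (pseries_fps_mul (qpoch 2 2)) in Delta_eq.
by rewrite -!qpoch_dil ?muln_gt0.
Qed.

(** The factor F = E_2 / E^3 does not depend on k, and E psi = E_2^2 turns it
    into psi^3 / E_2^5, whose denominator is a fifth power. *)
Lemma Delta_factor k m : (2 * k + 1 = 125 * m)%N -> (0 < m)%N ->
  exists f g, PSeries (Delta k) = f * dil 125 g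
    /\ f * dil 2 eul ^+ 5 = psi ^+ 3.
Proof.
move=> km m_gt0; pose f := dil 2 eul * ps_inv (eul ^+ 3).
have e3_0 : (eul ^+ 3) 0%N = 1 by rewrite coefpsX0 eul0.
have em0 : dil (2 * m) eul 0%N = 1 by rewrite dil_coef0 eul0.
have f_eul : f * eul ^+ 3 = dil 2 eul.
  by rewrite /f -mulrA [_ * eul ^+ 3]mulrC ps_mulfV ?mulr1.
exists f, (dil m eul * ps_inv (dil (2 * m) eul)); split.
  have e0 : (eul ^+ 3 * dil (2 * (2 * k + 1)) eul) 0%N = 1.
    by rewrite coefpsM0 e3_0 dil_coef0 eul0.
  apply: (ps_cancel e0); rewrite mulrC Delta_series km.
  have -> : dil (2 * (125 * m)) eul = dil 125 (dil (2 * m) eul).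
    by rewrite dil_dil // mulnCA.
  have -> : dil (125 * m) eul = dil 125 (dil m eul) by rewrite dil_dil.
  transitivity (f * eul ^+ 3 * dil 125 (dil m eul
    * (dil (2 * m) eul * ps_inv (dil (2 * m) eul)))).
    by rewrite f_eul ps_mulfV // mulr1.
  by rewrite !(rmorphM (dil 125)) /=; ring.
apply: (ps_cancel e3_0).
transitivity (f * eul ^+ 3 * dil 2 eul ^+ 5); first by ring.
by rewrite f_eul -exprS (_ : 6 = 2 * 3)%N // exprM -eul_psi exprMn; ring.
Qed.

Theorem theorem1p2 (k : nat) (k_gt0 : (0 < k)%N) (hk : (k = 62 %[mod 125])%N)
    (n : nat) :
  (Delta k (125 * n + 99)%N = 0 %[mod 25])%Z.
Proof.
have [m km] : exists m, (2 * k + 1 = 125 * m)%N.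
  by exists (2 * (k %/ 125) + 1)%N; rewrite {1}(divn_eq k 125) hk; lia.
have m_gt0 : (0 < m)%N by lia.
have [f [g [Delta_fg f_psi]]] := Delta_factor km m_gt0.
have [P0 [P1 [y [z [k' [theta_eq eta_eq [k'0 z0] [eP0 eP1 ey eq]]]]]]] :=
  level10_parameters.
have [h f_sect] := third_sect theta_eq eta_eq k'0 z0 eP0 eP1 ey eq f_psi.
have dilE : dil 125 g = dil 5 (dil 5 (dil 5 g)) by rewrite !dil_dil.
have sect_Delta : sect 5 3 (sect 5 4 (sect 5 4 (PSeries (Delta k))))
    = 25%:R * (g * h).
  rewrite Delta_fg dilE mulrC !sect_dilM // f_sect add0r.
  by ring.
have /pseriesP/(_ n) := sect_Delta; rewrite coefps_natl /=.
have -> : (5 * (5 * (5 * n + 3) + 4) + 4 = 125 * n + 99)%N by lia.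
by move=> ->; rewrite mod0z natz modzMr.
Qed.
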